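(* Let $m\in\mathbb{N}$. For any centered Gaussian random vector $(X_1,X_2,X_3,X_4)$ (each $X_i$ real-valued with positive variance), $$E[X_1^{2m}X_2^{2}X_3^{2}X_4^{2}]\ge E[X_1^{2m}]\,E[X_2^{2}]\,E[X_3^{2}]\,E[X_4^{2}],$$ and equality holds if and only if $X_1,X_2,X_3,X_4$ are independent.
   Context: All Gaussian random variables are assumed real-valued and non-degenerate (positive variance). $\mathbb{N}=\{1,2,3,\dots\}$. *)

(* Defs.v *)
From HB Require Import structures.
From mathcomp Require Import all_boot all_order all_algebra.
From mathcomp Require Import all_classical all_reals all_analysis.
Set Implicit Arguments. Unset Strict Implicit. Unset Printing Implicit Defensive.
Import Order.TTheory GRing.Theory Num.Theory.
Local Open Scope classical_set_scope.
Local Open Scope ring_scope.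

Section defs.
Context {d : measure_display} {T : measurableType d} {R : realType}.

Definition vec4 (X1 X2 X3 X4 : T -> R) : 'I_4 -> T -> R :=
  fun i => match val i with 0%N => X1 | 1%N => X2 | 2%N => X3 | _ => X4 end.

(* (X_i)_{i<n} is a centered Gaussian random vector: every linear combination
   sum_i a_i X_i is a centered (possibly degenerate) Gaussian random variable,
   i.e. its law is N(0, s^2) with s <> 0, or it is a.s. equal to 0. *)
Definition centered_gaussian_vector (P : probability T R) (n : nat)
    (X : 'I_n -> T -> R) : Prop :=
  forall a : 'I_n -> R,
    let Y := fun w => \sum_(i < n) a i * X i w in
    (exists s : R, s != 0 /\
       forall A : set R, measurable A -> P (Y @^-1` A) = normal_prob 0 s A)
    \/ P [set w | Y w = 0] = 1%E.

(* Mutual independence of the random variables (X_i)_{i<n}. Taking B i = setT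
   for the indices not involved recovers the product rule for every
   subfamily. *)
Definition mutually_independent (P : probability T R) (n : nat)
    (X : 'I_n -> T -> R) : Prop :=
  forall B : 'I_n -> set R, (forall i, measurable (B i)) ->
    P (\bigcap_(i in [set: 'I_n]) (X i @^-1` B i)) =
    (\prod_(i < n) P (X i @^-1` B i))%E.

End defs.

(* Main.v *)
Require Import Defs.
From HB Require Import structures.
From mathcomp Require Import all_boot all_order all_algebra.
From mathcomp Require Import all_classical all_reals all_analysis.
From mathcomp Require Import measurable_realfun ring lra.
Import Order.TTheory GRing.Theory Num.Theory.
Local Open Scope classical_set_scope.
Local Open Scope ring_scope.

(** Normalize V = X_1 / sd(X_1) and write X_j = a_j V + Y_j with Y_j uncorrelated
    with V.  Wick's formula gives E[V^2m X_2^2 X_3^2 X_4^2] = E[V^2m] f, where f is a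
    polynomial in u = 2m, the a_j and the covariances of the Y_j.  For every u >= 2 the
    difference f - E[X_2^2] E[X_3^2] E[X_4^2] is a sum of squares in the Y_j regarded as
    vectors of a Euclidean space: it is nonnegative, and it leaves enough slack to force
    all correlations to vanish in case of equality.

    Wick's formula follows from the one-dimensional moments by polarization.
    Uncorrelated components of a Gaussian vector are independent because their mixed
    moments factor and polynomials are complete: if H is orthogonal to all powers of
    Y, then, by Taylor expansion, to all exp(-s (Y - y)^2), hence to the polynomials
    (1 - w^2n)^(n 4^n) in such a w, which converge to the indicator of w < 1/2, hence to
    all intervals of Y. *)

Set Implicit Arguments.
Unset Strict Implicit.
Unset Printing Implicit Defensive.

(** * A sum of squares *)

(** The hypothesis gives only the law of each linear combination, and the covariance matrix may be
    singular, so there is no joint density to integrate against: joint moments and independence both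
    have to be extracted from one-dimensional laws. Orthogonality to all powers does not in general
    imply orthogonality to bounded functions, since a moment problem may be indeterminate;
    integrability of some exp(c Y^2) excludes this. The Taylor series of exp(-s Y^2) is dominated in
    this way only for s up to c/2, so larger rates are reached by multiplying small Gaussian
    factors, each of which preserves orthogonality to all powers. *)

Section Algebraic.
Variable R : realFieldType.
Implicit Types u a b c A B C p q r : R.

(* The covariance matrix of (Y_1, Y_2, Y_3): diagonal A, B, C and off-diagonal entries
   p = s_23, q = s_13, r = s_12. *)
Definition qform3 A B C p q r (x y z : R) : R :=
  A * x ^+ 2 + B * y ^+ 2 + C * z ^+ 2 + 2 * (p * y * z + q * x * z + r * x * y).

Definition polar3 A B C p q r (x y z x' y' z' : R) : R :=
  A * x * x' + B * y * y' + C * z * z' + p * (y * z' + z * y') +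
  q * (x * z' + z * x') + r * (x * y' + y * x').

(* E[V^u X_1^2 X_2^2 X_3^2] / E[V^u] for Gaussian V, X_1, X_2, X_3 and even u, where V has
   variance 1 and covariances a, b, c with the X_j, whose own covariances are A, ..., r. *)
Definition tilted_moment u a b c A B C p q r : R :=
  (A * B * C + 2 * (A * p ^+ 2 + B * q ^+ 2 + C * r ^+ 2) + 8 * p * q * r) +
  u * (a ^+ 2 * (B * C + 2 * p ^+ 2) + b ^+ 2 * (A * C + 2 * q ^+ 2) +
       c ^+ 2 * (A * B + 2 * r ^+ 2) + 4 * a * b * (r * C + 2 * p * q) +
       4 * a * c * (q * B + 2 * p * r) + 4 * b * c * (p * A + 2 * q * r)) +
  u * (u - 2) * (a ^+ 2 * b ^+ 2 * C + a ^+ 2 * c ^+ 2 * B +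
       b ^+ 2 * c ^+ 2 * A + 4 * a * b * c * (a * p + b * q + c * r)) +
  u * (u - 2) * (u - 4) * (a ^+ 2 * b ^+ 2 * c ^+ 2).

(** Positivity of the tensor product of the semidefinite matrix with rows [(x, y)] and [(y, z)] with
    the semidefinite form. Multiplication by [z] completes the square: the value of the form at
    [z U + y V], plus [x z - y^2] times its value at [V]. *)
Lemma quadratic_pair_ge0 A B C p q r (x y z k l m : R) (V1 V2 V3 U1 U2 U3 : R) :
  (forall x y z, 0 <= qform3 A B C p q r x y z) ->
  0 < z -> y ^+ 2 <= x * z ->
  0 <= x * qform3 A B C p q r V1 V2 V3 +
       2 * y * polar3 A B C p q r V1 V2 V3 U1 U2 U3 +
       z * qform3 A B C p q r U1 U2 U3.
Proof.
move=> psd z0 yxz.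
rewrite -(pmulr_rge0 _ z0).
set W := (X in 0 <= X).
have -> : W = qform3 A B C p q r (z * U1 + y * V1) (z * U2 + y * V2) (z * U3 + y * V3)
   + (x * z - y ^+ 2) * qform3 A B C p q r V1 V2 V3.
  by rewrite /W /qform3 /polar3; ring.
by rewrite addr_ge0 ?psd// mulr_ge0 ?psd// subr_ge0.
Qed.

(* Twice the squared norm of the symmetric tensor a y_2 y_3 + b y_1 y_3 + c y_1 y_2. *)
Lemma gram_sym_ge0 A B C p q r a b c :
  (forall x y z, 0 <= qform3 A B C p q r x y z) ->
  0 <= (a ^+ 2 * (B * C + p ^+ 2) + b ^+ 2 * (A * C + q ^+ 2) +
        c ^+ 2 * (A * B + r ^+ 2)) +
   2 * (a * b * (r * C + p * q) + a * c * (q * B + p * r) +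
              b * c * (p * A + q * r)).
Proof.
move=> psd.
have A0 : 0 <= A by have := psd 1 0 0; rewrite /qform3; lra.
have B0 : 0 <= B by have := psd 0 1 0; rewrite /qform3; lra.
have C0 : 0 <= C by have := psd 0 0 1; rewrite /qform3; lra.
move: C0; rewrite le_eqVlt => /orP[/eqP C0|C0]; last first.
  rewrite -(pmulr_rge0 _ (exprn_gt0 2 C0)).
  set W := (X in 0 <= X).
  (* These are the entries of [C] times the Schur complement of [C]; [zz] evaluates the form at the
     third coordinate that minimizes it. *)
  pose z11 := A * C - q ^+ 2. pose z22 := B * C - p ^+ 2. pose z12 := r * C - p * q.
  have zz x y : 0 <= z11 * x ^+ 2 + z22 * y ^+ 2 + 2 * z12 * x * y.
    rewrite -(pmulr_rge0 _ C0).
    have := psd (C * x) (C * y) (- (q * x + p * y)).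
    suff -> : qform3 A B C p q r (C * x) (C * y) (- (q * x + p * y)) =
      C * (z11 * x ^+ 2 + z22 * y ^+ 2 + 2 * z12 * x * y) by [].
    by rewrite /qform3 /z11 /z22 /z12; ring.
  have z1 : 0 <= z11 by have := zz 1 0; lra.
  have z2 : 0 <= z22 by have := zz 0 1; lra.
  have -> : W = 2 * ((a * p + b * q) * C + c * p * q) ^+ 2 +
     (z22 * (a * C + c * q) ^+ 2 + z11 * (b * C + c * p) ^+ 2
       + 2 * z12 * (b * C + c * p) * (a * C + c * q)) +
     c ^+ 2 * (z11 * z22 + z12 ^+ 2).
    by rewrite /W /z11 /z22 /z12; ring.
  have := zz (b * C + c * p) (a * C + c * q).
  have : 0 <= c ^+ 2 * (z11 * z22 + z12 ^+ 2).
    by rewrite mulr_ge0 ?sqr_ge0// addr_ge0 ?sqr_ge0// mulr_ge0.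
  have := sqr_ge0 ((a * p + b * q) * C + c * p * q).
  lra.
(* For [C = 0] the form is affine in its third coordinate, and an affine function that stays
   nonnegative has slope zero; this removes [p] and [q]. *)
have isq0 (D t : R) : (forall x, 0 <= D + 2 * t * x) -> t = 0.
  move=> h; apply/eqP/negPn/negP => t0.
  have := h (- (D + 1) / (2 * t)).
  have -> : D + 2 * t * (- (D + 1) / (2 * t)) = -1 by field; rewrite t0.
  lra.
have p0 : p = 0.
  by apply: (isq0 B) => x; have := psd 0 1 x; rewrite /qform3 -C0; lra.
have q0 : q = 0.
  by apply: (isq0 A) => x; have := psd 1 0 x; rewrite /qform3 -C0; lra.
rewrite p0 q0 -C0.
have -> : a ^+ 2 * (B * 0 + 0 ^+ 2) + b ^+ 2 * (A * 0 + 0 ^+ 2) + c ^+ 2 * (A * B + r ^+ 2) +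
  2 * (a * b * (r * 0 + 0 * 0) + a * c * (0 * B + 0 * r) + b * c * (0 * A + 0 * r)) =
  c ^+ 2 * (A * B + r ^+ 2) by ring.
by rewrite mulr_ge0 ?sqr_ge0// addr_ge0 ?sqr_ge0// mulr_ge0.
Qed.

(** Cauchy-Schwarz for the vectors with coordinates [v] and [w] along the [y_i]; the gap between the
    two sides is the squared norm of their wedge product. The form may be singular, so a null second
    vector is treated apart. *)
Lemma gram_antisym_ge0 A B C p q r (v1 v2 v3 w1 w2 w3 : R) :
  (forall x y z, 0 <= qform3 A B C p q r x y z) ->
  polar3 A B C p q r v1 v2 v3 w1 w2 w3 ^+ 2 <=
  qform3 A B C p q r v1 v2 v3 * qform3 A B C p q r w1 w2 w3.
Proof.
move=> psd.
set P := polar3 _ _ _ _ _ _ _ _ _ _ _ _; set V := qform3 _ _ _ _ _ _ v1 v2 v3.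
set W := qform3 _ _ _ _ _ _ w1 w2 w3.
have h x y : 0 <= V * x ^+ 2 + 2 * P * x * y + W * y ^+ 2.
  have := psd (x * v1 + y * w1) (x * v2 + y * w2) (x * v3 + y * w3).
  suff -> : qform3 A B C p q r (x * v1 + y * w1) (x * v2 + y * w2) (x * v3 + y * w3)
   = V * x ^+ 2 + 2 * P * x * y + W * y ^+ 2 by [].
  by rewrite /P /V /W /qform3 /polar3; ring.
have W0 : 0 <= W by exact: psd.
move: W0; rewrite le_eqVlt => /orP[/eqP W0|W0]; last first.
  rewrite -subr_ge0 -(pmulr_rge0 _ W0).
  by have := h W (- P); congr (_ <= _); ring.
suff -> : P = 0 by rewrite -W0 expr2 !mulr0.
apply/eqP/negPn/negP => P0.
have := h 1 (- (V + 1) / (2 * P)).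
have -> : V * 1 ^+ 2 + 2 * P * 1 * (- (V + 1) / (2 * P)) + W * (- (V + 1) / (2 * P)) ^+ 2 = -1.
  by rewrite -W0; field; rewrite P0.
lra.
Qed.

(* The certificate is symmetric under permutations of the indices.  Its Gram matrix on the
   vectors bc y_1, ac y_2, ab y_3, p y_1, q y_2, r y_3 splits into a part [t] on their sums
   and a part [g] on their differences; [hs] is a form in the scalars abc and ap + bq + cr,
   and the other two terms are norms of symmetric and antisymmetric tensors.  The
   coefficients were found by solving the resulting small semidefinite program so that
   all blocks remain definite, with slack [e], for all u >= 2. *)
Lemma tilted_moment_ge u a b c A B C p q r : 2 <= u ->
  (forall x y z, 0 <= qform3 A B C p q r x y z) ->
  10%:R^-1 * (a ^+ 2 * b ^+ 2 * C + a ^+ 2 * c ^+ 2 * B + b ^+ 2 * c ^+ 2 * A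
     + (A * p ^+ 2 + B * q ^+ 2 + C * r ^+ 2) + a ^+ 2 * b ^+ 2 * c ^+ 2) <=
  tilted_moment u a b c (A + a ^+ 2) (B + b ^+ 2) (C + c ^+ 2)
     (p + b * c) (q + a * c) (r + a * b)
  - (A + a ^+ 2) * (B + b ^+ 2) * (C + c ^+ 2).
Proof.
move=> u2 psd; rewrite -subr_ge0.
pose N := qform3 A B C p q r; pose L := polar3 A B C p q r.
(* [v0], [k0], [w0] are the diagonal and [v1], [k1], [w1] the off-diagonal entries of blocks
   invariant under permutation of the three indices. Such a block acts as diagonal plus twice
   off-diagonal on the sum and as diagonal minus off-diagonal on the differences, which gives [t],
   [g] and the factor [3^-1] below. The slack [e] is taken out of [v0], [w0] and [d], the
   coefficients of the terms on the left of the claim. *)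
pose e : R := 10%:R^-1.
pose v0 := u ^+ 2 + 4 * u + 2 - e.
pose v1 := 2 / 3 * (u + 1) ^+ 2.
pose k0 := 2 + 5 / 4 * u.
pose k1 := 1 + 7 / 8 * u.
pose w0 : R := 2 - e.
pose w1 : R := 4 / 3.
pose d := (1 + u) * (3 + u) * (5 + u) - 1 - e.
pose f := 4 / 3 * (u + 1) * (u + 4).
pose s := a * p + b * q + c * r.
pose t V1 V2 V3 U1 U2 U3 :=
  (v0 + 2 * v1) * N V1 V2 V3 + 2 * (k0 + 2 * k1) * L V1 V2 V3 U1 U2 U3 +
  (w0 + 2 * w1) * N U1 U2 U3.
pose g V1 V2 V3 U1 U2 U3 :=
  (v0 - v1) * N V1 V2 V3 + 2 * (k0 - k1) * L V1 V2 V3 U1 U2 U3 +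
  (w0 - w1) * N U1 U2 U3.
have ht : 0 <= t (b * c) (a * c) (a * b) p q r.
  apply: quadratic_pair_ge0 => //; rewrite /w0 /w1 /v0 /v1 /k0 /k1 /e; first by lra.
  nra.
have hg V1 V2 V3 U1 U2 U3 : 0 <= g V1 V2 V3 U1 U2 U3.
  apply: quadratic_pair_ge0 => //; rewrite /w0 /w1 /v0 /v1 /k0 /k1 /e; first by lra.
  nra.
have hs : 0 <= d * (a * b * c) ^+ 2 + 2 * f * (a * b * c) * s + 2 * (1 + u) * s ^+ 2.
  have u1 : 0 < 2 * (1 + u) by lra.
  rewrite -(pmulr_rge0 _ u1).
  have -> : 2 * (1 + u) * (d * (a * b * c) ^+ 2 + 2 * f * (a * b * c) * s + 2 * (1 + u) * s ^+ 2)
    = (2 * (1 + u) * s + f * (a * b * c)) ^+ 2 +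
      (1 + u) * (2 * d - 16 / 9 * (u + 1) * (u + 4) ^+ 2) * (a * b * c) ^+ 2.
    by rewrite /f; field.
  rewrite addr_ge0 ?sqr_ge0// mulr_ge0 ?sqr_ge0// mulr_ge0//; first by lra.
  rewrite /d /e; nra.
have hT := gram_sym_ge0 a b c psd.
have h12 := gram_antisym_ge0 b a 0 0 0 1 psd.
have h13 := gram_antisym_ge0 c 0 a 0 1 0 psd.
have h23 := gram_antisym_ge0 0 c b 1 0 0 psd.
set G := (X in 0 <= X).
have -> : G = 3^-1 * (t (b * c) (a * c) (a * b) p q r +
   g (b * c) (- (a * c)) 0 p (- q) 0 + g (b * c) 0 (- (a * b)) p 0 (- r) +
   g 0 (a * c) (- (a * b)) 0 q (- r)) +
   (d * (a * b * c) ^+ 2 + 2 * f * (a * b * c) * s + 2 * (1 + u) * s ^+ 2) +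
   u / 2 * ((a ^+ 2 * (B * C + p ^+ 2) + b ^+ 2 * (A * C + q ^+ 2) +
        c ^+ 2 * (A * B + r ^+ 2)) +
   2 * (a * b * (r * C + p * q) + a * c * (q * B + p * r) +
              b * c * (p * A + q * r))) +
   u / 4 * ((N b a 0 * N 0 0 1 - L b a 0 0 0 1 ^+ 2) +
            (N c 0 a * N 0 1 0 - L c 0 a 0 1 0 ^+ 2) +
            (N 0 c b * N 1 0 0 - L 0 c b 1 0 0 ^+ 2)).
  rewrite /G /t /g /N /L /qform3 /polar3 /tilted_moment /s /d /f /v0 /v1 /k0 /k1 /w0 /w1 /e.
  by field.
have ug : 0 <= u by lra.
have u20 : 0 <= u / 2 by lra.
have u40 : 0 <= u / 4 by lra.
rewrite -subr_ge0 in h12; rewrite -subr_ge0 in h13; rewrite -subr_ge0 in h23.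
apply: addr_ge0; last exact: mulr_ge0 u40 (addr_ge0 (addr_ge0 h12 h13) h23).
apply: addr_ge0; last exact: mulr_ge0 u20 hT.
apply: addr_ge0 hs; apply: mulr_ge0; first by lra.
exact: addr_ge0 (addr_ge0 (addr_ge0 ht (hg _ _ _ _ _ _)) (hg _ _ _ _ _ _)) (hg _ _ _ _ _ _).
Qed.

Lemma prod_le_tilted_moment u a b c A B C p q r : 2 <= u ->
  (forall x y z, 0 <= qform3 A B C p q r x y z) ->
  (A + a ^+ 2) * (B + b ^+ 2) * (C + c ^+ 2) <=
  tilted_moment u a b c (A + a ^+ 2) (B + b ^+ 2) (C + c ^+ 2)
     (p + b * c) (q + a * c) (r + a * b).
Proof.
move=> u2 psd; rewrite -subr_ge0.
apply: le_trans (tilted_moment_ge a b c u2 psd).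
have A0 : 0 <= A by have := psd 1 0 0; rewrite /qform3; lra.
have B0 : 0 <= B by have := psd 0 1 0; rewrite /qform3; lra.
have C0 : 0 <= C by have := psd 0 0 1; rewrite /qform3; lra.
rewrite mulr_ge0 ?invr_ge0//.
by repeat first [exact: sqr_ge0 | assumption | apply: addr_ge0 | apply: mulr_ge0].
Qed.

(** Equality makes every slack term vanish. Positive variances then give [ab = ac = bc = 0], so at
    most one of [a], [b], [c] is nonzero. If it is [a], then [B] and [C] are positive, [q = r = 0],
    and the remaining excess [a^2 (u B C + (2 + 2 u) p^2)] would be positive. *)
Lemma tilted_moment_eq u a b c A B C p q r : 2 <= u ->
  (forall x y z, 0 <= qform3 A B C p q r x y z) ->
  0 < A + a ^+ 2 -> 0 < B + b ^+ 2 -> 0 < C + c ^+ 2 ->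
  tilted_moment u a b c (A + a ^+ 2) (B + b ^+ 2) (C + c ^+ 2)
     (p + b * c) (q + a * c) (r + a * b) =
  (A + a ^+ 2) * (B + b ^+ 2) * (C + c ^+ 2) ->
  [/\ a = 0, b = 0 & c = 0] /\ [/\ p = 0, q = 0 & r = 0].
Proof.
move=> u2 psd Aa Bb Cc E.
have := tilted_moment_ge a b c u2 psd; rewrite E subrr => h.
have A0 : 0 <= A by have := psd 1 0 0; rewrite /qform3; lra.
have B0 : 0 <= B by have := psd 0 1 0; rewrite /qform3; lra.
have C0 : 0 <= C by have := psd 0 0 1; rewrite /qform3; lra.
have nM (x y : R) : 0 <= x -> 0 <= y ^+ 2 * x by move=> ?; rewrite mulr_ge0 ?sqr_ge0.
have hC : 0 <= a ^+ 2 * b ^+ 2 * C by rewrite -mulrA !nM.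
have hB : 0 <= a ^+ 2 * c ^+ 2 * B by rewrite -mulrA !nM.
have hA : 0 <= b ^+ 2 * c ^+ 2 * A by rewrite -mulrA !nM.
have hp : 0 <= A * p ^+ 2 by rewrite mulrC nM.
have hq : 0 <= B * q ^+ 2 by rewrite mulrC nM.
have hr : 0 <= C * r ^+ 2 by rewrite mulrC nM.
have habc : 0 <= a ^+ 2 * b ^+ 2 * c ^+ 2 by rewrite -mulrA !nM ?sqr_ge0.
have pos0 (x y : R) : 0 < y -> x ^+ 2 * y = 0 -> x = 0.
  move=> y0 /eqP; rewrite mulf_eq0 sqrf_eq0 (gt_eqF y0) orbF.
  by move=> /eqP.
have ab : a * b = 0.
  apply: (pos0 _ _ Cc); have -> : (a * b) ^+ 2 * (C + c ^+ 2) =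
    a ^+ 2 * b ^+ 2 * C + a ^+ 2 * b ^+ 2 * c ^+ 2 by ring.
  lra.
have ac : a * c = 0.
  apply: (pos0 _ _ Bb); have -> : (a * c) ^+ 2 * (B + b ^+ 2) =
    a ^+ 2 * c ^+ 2 * B + a ^+ 2 * b ^+ 2 * c ^+ 2 by ring.
  lra.
have bc : b * c = 0.
  apply: (pos0 _ _ Aa); have -> : (b * c) ^+ 2 * (A + a ^+ 2) =
    b ^+ 2 * c ^+ 2 * A + a ^+ 2 * b ^+ 2 * c ^+ 2 by ring.
  lra.
have p0 : 0 < A -> p = 0 by move=> /pos0; apply; lra.
have q0 : 0 < B -> q = 0 by move=> /pos0; apply; lra.
have r0 : 0 < C -> r = 0 by move=> /pos0; apply; lra.
have sq0 (x : R) : 0 <= x ^+ 2 by exact: sqr_ge0.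
have zero (x y : R) : x != 0 -> x * y = 0 -> y = 0.
  by move=> x0 /eqP; rewrite mulf_eq0 (negbTE x0) => /eqP.
have single (x Y Z w X : R) : x ^+ 2 * (u * Y * Z + w ^+ 2 * X) = 0 ->
    0 < Y -> 0 < Z -> 0 <= X -> x = 0.
  move=> e Y0 Z0 X0; apply: (pos0 _ _ _ e).
  apply: ltr_pwDl; last exact: nM.
  by rewrite !mulr_gt0//; lra.
have a0 : a = 0.
  apply/eqP/negPn/negP => an0.
  have b0 := zero _ _ an0 ab; have c0 := zero _ _ an0 ac.
  move: Bb Cc E hp; rewrite b0 c0 expr0n !addr0 => Bb Cc E hp'.
  rewrite (q0 Bb) (r0 Cc) in E.
  move/eqP: an0; apply; apply: (single a B C p (2 + 2 * u)) => //; last by lra.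
  by move: E; rewrite /tilted_moment; lra.
have b0 : b = 0.
  apply/eqP/negPn/negP => bn0.
  have c0 := zero _ _ bn0 bc.
  move: Aa Cc E; rewrite a0 c0 expr0n !addr0 => Aa Cc E.
  rewrite (p0 Aa) (r0 Cc) in E.
  move/eqP: bn0; apply; apply: (single b A C q (2 + 2 * u)) => //; last by lra.
  by move: E; rewrite /tilted_moment; lra.
have c0 : c = 0.
  apply/eqP/negPn/negP => cn0.
  move: Aa Bb E; rewrite a0 b0 expr0n !addr0 => Aa Bb E.
  rewrite (p0 Aa) (q0 Bb) in E.
  move/eqP: cn0; apply; apply: (single c A B r (2 + 2 * u)) => //; last by lra.
  by move: E; rewrite /tilted_moment; lra.
move: Aa Bb Cc; rewrite a0 b0 c0 expr0n !addr0 => /p0 -> /q0 -> /r0 ->.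
by split; split.
Qed.

End Algebraic.

(** * Integrals against the normal density *)

Section NormalIntegrals.
Import numFieldNormedType.Exports.
Context {R : realType}.
Implicit Types (s c x : R) (k n : nat).
Notation mu := (@lebesgue_measure R).

(** The Radon-Nikodym derivative of [normal_prob] agrees almost everywhere with [normal_pdf],
    because both have the same integral over every measurable set. *)
Lemma ge0_integral_normal_prob s (f : R -> \bar R) :
  measurable_fun [set: R] f -> (forall x, 0 <= f x)%E ->
  (\int[normal_prob 0 s]_x f x = \int[mu]_x (f x * (normal_pdf 0 s x)%:E))%E.
Proof.
move=> mf f0.
pose N : {finite_measure set (measurableTypeR R) -> \bar R} := normal_prob (0 : R) s.
have dom : N `<< mu by exact: normal_prob_dominates.
rewrite -(@Radon_Nikodym_SigmaFinite.change_of_variables _ _ _ N mu dom f setT)//.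
apply: ae_eq_integral => //.
- apply: emeasurable_funM => //.
  exact: measurable_int (Radon_Nikodym_SigmaFinite.f_integrable dom).
- apply: emeasurable_funM => //; apply/measurable_EFinP; exact: measurable_normal_pdf.
apply: ae_eqe_mul2l; apply: integral_ae_eq => //.
- exact: Radon_Nikodym_SigmaFinite.f_integrable.
- apply/measurable_EFinP; exact: measurable_normal_pdf.
- by move=> A _ mA; rewrite -Radon_Nikodym_SigmaFinite.f_integral.
Qed.

(* Up to a factor 2 the integrand is the density of N(0, (2 s)^2). *)
Lemma integral_normal_expsq s : s != 0 ->
  (\int[normal_prob 0 s]_x (expR (3 / (8 * s ^+ 2) * x ^+ 2))%:E = 2%:E)%E.
Proof.
move=> s0.
have me : measurable_fun [set: R] (fun x => (expR (3 / (8 * s ^+ 2) * x ^+ 2))%:E).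
  by apply/measurable_EFinP; apply: measurableT_comp => //; exact: measurable_funM.
rewrite ge0_integral_normal_prob//.
have ss0 : 2 * s != 0 by rewrite mulf_neq0.
transitivity (\int[mu]_x (2%:E * (normal_pdf 0 (2 * s) x)%:E))%E; last first.
  have mp : measurable_fun [set: R] (fun x => (normal_pdf 0 (2 * s) x)%:E).
    by apply/measurable_EFinP; exact: measurable_normal_pdf.
  rewrite ge0_integralZl//; first by rewrite integral_normal_pdf mule1.
  by move=> x _; rewrite lee_fin normal_pdf_ge0.
apply: eq_integral => x _; rewrite -!EFinM !normal_pdfE//; congr (_%:E).
rewrite /normal_peak /normal_fun.
have -> : Num.sqrt ((2 * s) ^+ 2 * pi *+ 2) = 2 * Num.sqrt (s ^+ 2 * pi *+ 2).
  rewrite (_ : (2 * s) ^+ 2 * pi *+ 2 = 2 ^+ 2 * (s ^+ 2 * pi *+ 2)).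
    by rewrite sqrtrM ?sqr_ge0// sqrtr_sqr ger0_norm.
  by ring.
(* The rate [3 / (8 s^2)] is the difference of the rates [1 / (2 s^2)] and [1 / (2 (2 s)^2)] of the
   two densities. *)
have -> : 3 / (8 * s ^+ 2) * x ^+ 2 =
    (- (x - 0) ^+ 2 / ((2 * s) ^+ 2 *+ 2)) - (- (x - 0) ^+ 2 / (s ^+ 2 *+ 2)).
  by field.
set e := expR (- _ / (s ^+ 2 *+ 2)).
rewrite expRB (mulrC _^-1) mulrA divfK ?gt_eqF ?expR_gt0// (invfM 2) mulrC.
by rewrite -(mulrA 2^-1) mulVKf// pnatr_eq0.
Qed.

(** A single term of the exponential series; thus one integrable exponential dominates all even
    powers. *)
Lemma expr_le_expR c x k : 0 < c -> x ^+ (2 * k) <= k`!%:R / c ^+ k * expR (c * x ^+ 2).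
Proof.
move=> c0; have c1 : 0 < c ^+ k by rewrite exprn_gt0.
rewrite mulrAC ler_pdivlMr// exprM -exprMn.
rewrite -ler_pdivrMl ?ltr0n ?fact_gt0//.
case: k {c1} => [|k]; first by rewrite expr0 invr1 mulr1 -expR0 ler_expR mulr_ge0 ?sqr_ge0 ?ltW.
have h : 0 <= c * x ^+ 2 by rewrite mulr_ge0 ?sqr_ge0 ?ltW.
rewrite (mulrC _^-1) mulrC (le_trans _ (expR_ge1Dxn k h))// mulrC [x ^+ 2 * c]mulrC.
by rewrite mulrC lerDr.
Qed.

Lemma integrable_normal_expsq s : s != 0 ->
  mu.-integrable [set: R] (fun x => (expR (3 / (8 * s ^+ 2) * x ^+ 2) * normal_pdf 0 s x)%:E).
Proof.
move=> s0; have me : measurable_fun [set: R] (fun x => expR (3 / (8 * s ^+ 2) * x ^+ 2)).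
  by apply: measurableT_comp => //; exact: measurable_funM.
apply/integrableP; split.
  by apply/measurable_EFinP; apply: measurable_funM => //; exact: measurable_normal_pdf.
have := integral_normal_expsq s0; rewrite ge0_integral_normal_prob//.
  move=> e; rewrite (_ : integral _ _ _ = 2%:E) ?ltry// -e; apply: eq_integral => x _.
  by rewrite gee0_abs// lee_fin mulr_ge0 ?expR_ge0 ?normal_pdf_ge0.
by apply/measurable_EFinP.
Qed.

Lemma integrable_normal_moment s k : s != 0 ->
  mu.-integrable [set: R] (fun x => (x ^+ (2 * k) * normal_pdf 0 s x)%:E).
Proof.
move=> s0; have c0 : 0 < 3 / (8 * s ^+ 2).
  by apply: divr_gt0 => //; apply: mulr_gt0 => //; rewrite exprn_even_gt0.
pose C : R := k`!%:R / (3 / (8 * s ^+ 2)) ^+ k.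
apply: (le_integrable measurableT _ _ (integrableZl measurableT C (integrable_normal_expsq s0))) => //.
  by apply/measurable_EFinP; apply: measurable_funM => //; exact: measurable_normal_pdf.
move=> x _ /=; rewrite lee_fin.
have e0 : 0 <= x ^+ (2 * k) by rewrite exprn_even_ge0// oddM.
have C0 : 0 <= C by rewrite mulr_ge0 ?ler0n// invr_ge0 exprn_ge0// ltW.
have p0 := normal_pdf_ge0 0 s x.
rewrite [leLHS]ger0_norm; last exact: mulr_ge0.
apply: le_trans (ler_norm _); rewrite mulrA; apply: ler_wpM2r => //.
exact: expr_le_expR.
Qed.

Lemma is_derive_normal_pdf s x : s != 0 ->
  is_derive x 1 (normal_pdf 0 s) (- x / s ^+ 2 * normal_pdf 0 s x).
Proof.
move=> s0; rewrite normal_pdfE// /normal_fun.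
have -> : (fun x => normal_peak s * expR (- (x - 0) ^+ 2 / (s ^+ 2 *+ 2))) =
    (fun x => normal_peak s * expR (- (s ^+ 2 *+ 2)^-1 * x ^+ 2)).
  by apply/funext => y; rewrite subr0 !mulNr; congr (_ * expR (- _)); rewrite mulrC.
apply: is_derive_eq.
have -> : - (x - 0) ^+ 2 / (s ^+ 2 *+ 2) = - (s ^+ 2 *+ 2)^-1 * x ^+ 2 by field.
by rewrite /GRing.scale/=; field.
Qed.

Lemma normal_pdf_moment_bound s k : s != 0 ->
  exists K, forall x, x ^+ (2 * k) * normal_pdf 0 s x <= K.
Proof.
(* Half the decay rate of the density, so that the exponential times the density remains bounded. *)
move=> s0; have c0 : 0 < (4 * s ^+ 2)^-1.
  by rewrite invr_gt0; apply: mulr_gt0 => //; rewrite exprn_even_gt0.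
exists (k`!%:R / (4 * s ^+ 2)^-1 ^+ k * normal_peak s) => x.
apply: (@le_trans _ _ (k`!%:R / (4 * s ^+ 2)^-1 ^+ k *
    expR ((4 * s ^+ 2)^-1 * x ^+ 2) * normal_pdf 0 s x)).
  by rewrite ler_wpM2r ?normal_pdf_ge0// expr_le_expR.
rewrite -mulrA ler_wpM2l//.
  by rewrite mulr_ge0 ?ler0n// invr_ge0 exprn_ge0// ltW.
rewrite normal_pdfE// /normal_fun mulrCA -expRD ler_piMr ?normal_peak_ge0//.
rewrite -[leRHS]expR0 ler_expR.
have -> : (4 * s ^+ 2)^-1 * x ^+ 2 + - (x - 0) ^+ 2 / (s ^+ 2 *+ 2) = - ((4 * s ^+ 2)^-1 * x ^+ 2) by field.
by rewrite oppr_le0 mulr_ge0 ?sqr_ge0 ?ltW.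
Qed.

(** The derivative of [x^(2k+1)] times the density. The moment recursion says that its integral over
    the line vanishes. *)
Definition moment_deriv s k x :=
  (2 * k).+1%:R * (x ^+ (2 * k) * normal_pdf 0 s x) -
  (s ^+ 2)^-1 * (x ^+ (2 * k.+1) * normal_pdf 0 s x).

Lemma is_derive_moment s k x : s != 0 ->
  is_derive x 1 (fun x => x ^+ (2 * k).+1 * normal_pdf 0 s x) (moment_deriv s k x).
Proof.
move=> s0; have h := is_derive_normal_pdf x s0.
have hX : is_derive x (1 : R) (fun x => x ^+ (2 * k).+1) ((2 * k).+1%:R * x ^+ (2 * k)).
  have := is_deriveX (2 * k).+1 (is_derive_id x (1 : R)).
  by rewrite /GRing.scale/= mulr1 fctE.
apply: is_derive_eq; rewrite /moment_deriv mulnS /GRing.scale/=.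
by rewrite !exprS; field.
Qed.

Lemma continuous_moment_deriv s k : s != 0 -> continuous (moment_deriv s k).
Proof.
move=> s0 x; have cp := continuous_normal_pdf (m := 0) s0.
by apply: cvgB; apply: cvgM; try exact: cvg_cst; apply: cvgM; try exact: cp;
  exact: exprn_continuous.
Qed.

Lemma integrable_moment_deriv s k : s != 0 ->
  mu.-integrable [set: R] (EFin \o moment_deriv s k).
Proof.
move=> s0; apply: eq_integrable (integrableB measurableT
  (integrableZl measurableT (2 * k).+1%:R (integrable_normal_moment k s0))
  (integrableZl measurableT (s ^+ 2)^-1 (integrable_normal_moment k.+1 s0))) => //.
Qed.

Lemma integral_moment_deriv_itv s k n : s != 0 ->
  (\int[mu]_(x in `[(- n.+1%:R)%R, n.+1%:R]) (moment_deriv s k x)%:E =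
   (2 * n.+1%:R ^+ (2 * k).+1 * normal_pdf 0 s n.+1%:R)%:E)%E.
Proof.
move=> s0; have nn : - n.+1%:R < n.+1%:R :> R by rewrite gtrN.
pose F x := x ^+ (2 * k).+1 * normal_pdf 0 s x.
have dF x : derivable F x 1 by apply: ex_derive; exact: is_derive_moment.
have cF x : F y @[y --> x] --> F x.
  by apply: differentiable_continuous; apply/derivable1_diffP.
rewrite (@continuous_FTC2 _ _ F _ _ nn).
- rewrite -EFinB /F; congr (_%:E).
  have -> : normal_pdf 0 s (- n.+1%:R) = normal_pdf 0 s n.+1%:R.
    by rewrite !normal_pdfE// /normal_fun !subr0 sqrrN.
  by rewrite exprNn -signr_odd /= oddM /= expr1; ring.
- apply: continuous_subspaceT; exact: continuous_moment_deriv.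
- split; [by move=> x _| |].
  + exact: cvg_at_right_filter.
  + exact: cvg_at_left_filter.
- by move=> x _; rewrite derive1E; apply: derive_val; exact: is_derive_moment.
Qed.

(** Dominated convergence along growing symmetric intervals. The boundary term is [2 N^(2k+1)] times
    the density at [N], and it is of order [1/N] because [N^(2k+2)] times the density is bounded. *)
Lemma integral_moment_deriv s k : s != 0 ->
  (\int[mu]_x (moment_deriv s k x)%:E = 0)%E.
Proof.
move=> s0.
pose A n : set R := `[(- n.+1%:R)%R, n.+1%:R]%classic.
pose h := moment_deriv s k.
have mh : measurable_fun [set: R] h.
  exact: continuous_measurable_fun (continuous_moment_deriv s0).
have ih : mu.-integrable [set: R] (EFin \o h) by exact: integrable_moment_deriv.
pose f n x := (h x * \1_(A n) x)%:E.
have cvgf : (\int[mu]_x f n x @[n --> \oo] --> \int[mu]_x (h x)%:E)%E.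
  apply: (@dominated_cvg _ _ _ mu setT measurableT f (EFin \o h)
    (fun x => `|h x|%:E)) => //.
  - move=> n; apply/measurable_EFinP; apply: measurable_funM => //.
    by apply: measurable_indic; exact: measurable_itv.
  - move=> x _; apply: cvg_near_cst.
    near=> n; rewrite /f indicE mem_set ?mulr1// /A/= in_itv/= -ler_norml.
    apply: (@le_trans _ _ n%:R); last by rewrite ler_nat.
    by near: n; exact: nbhs_infty_ger.
  - exact: (integrable_abse ih).
  - move=> n x _; rewrite /f lee_fin normrM ler_piMr//.
    by rewrite indicE; case: (_ \in _); rewrite ?normr1 ?normr0.
have [K hK] := normal_pdf_moment_bound k.+1 s0.
pose u n : R := 2 * n.+1%:R ^+ (2 * k).+1 * normal_pdf 0 s n.+1%:R.
have fu n : (\int[mu]_x f n x = (u n)%:E)%E.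
  rewrite /u -integral_moment_deriv_itv// [RHS]integral_mkcond.
  apply: eq_integral => x _; rewrite /f patchE indicE /A.
  by case: ifPn => _; rewrite ?mulr1 ?mulr0.
have cvg0 : (\int[mu]_x f n x @[n --> \oo] --> 0)%E.
  under eq_fun do rewrite fu.
  apply: cvg_EFin; first by apply: nearW.
  apply: (@squeeze_cvgr _ _ _ _ (fun _ => 0) (fun n => 2 * K * harmonic n)).
  - apply: nearW => n; rewrite /u /harmonic/=; apply/andP; split.
      by rewrite !mulr_ge0 ?normal_pdf_ge0 ?exprn_ge0.
    have := hK n.+1%:R; rewrite mulnS add2n exprSr mulrAC => hN.
    by rewrite ler_pdivlMr ?ltr0n// -!mulrA ler_pM2l// mulrA.
  - exact: cvg_cst.
  - rewrite -[X in _ --> X](mulr0 (2 * K)); apply: cvgM; first exact: cvg_cst.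
    exact: cvg_harmonic.
exact: (cvg_unique _ cvgf cvg0).
Unshelve. all: by end_near. Qed.

Lemma integral_normal_momentS s k : s != 0 ->
  (\int[normal_prob 0 s]_x (x ^+ (2 * k.+1))%:E =
   ((2 * k).+1%:R * s ^+ 2)%:E * \int[normal_prob 0 s]_x (x ^+ (2 * k))%:E)%E.
Proof.
move=> s0.
have red j : (\int[normal_prob 0 s]_x (x ^+ (2 * j))%:E =
    \int[mu]_x (x ^+ (2 * j) * normal_pdf 0 s x)%:E)%E.
  rewrite ge0_integral_normal_prob//; first exact/measurable_EFinP.
  by move=> x; rewrite lee_fin exprn_even_ge0// oddM.
rewrite !red.
have /= := integral_moment_deriv k s0; rewrite /moment_deriv.
under eq_integral do rewrite EFinB EFinM (EFinM (s ^- 2)).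
have i0 := integrable_normal_moment k s0; have i1 := integrable_normal_moment k.+1 s0.
rewrite integralB//; try exact: integrableZl.
rewrite !integralZl//.
have := integrable_fin_num measurableT i0; have := integrable_fin_num measurableT i1.
move=> /fineK <- /fineK <-; rewrite -!EFinM -EFinB => -[] e; congr EFin.
have ss : s ^+ 2 != 0 by rewrite sqrf_eq0.
move/eqP: e; rewrite subr_eq0 => /eqP e.
by rewrite mulrAC e mulrC mulrA divff// mul1r.
Qed.

Lemma integral_normal_sqr s : s != 0 ->
  (\int[normal_prob 0 s]_x (x ^+ 2)%:E = (s ^+ 2)%:E)%E.
Proof.
move=> s0; have := integral_normal_momentS 0 s0; rewrite muln1 => ->.
under eq_integral do rewrite expr0.
rewrite integral_cst//= mul1e muln0 mul1r.
by apply: etrans (congr1 _ (integral_normal_pdf 0 s)) _; rewrite mule1.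
Qed.

End NormalIntegrals.

(** * Random variables with all moments *)

Section AllMoments.
Import numFieldNormedType.Exports.
Context {d : measure_display} {T : measurableType d} {R : realType}.
Variable P : probability T R.
Implicit Types f g h : T -> R.

Definition mean f : R := \int[P]_w f w.

(** A class closed under sums and products, so that every polynomial in its members has a finite
    mean and integrability needs no separate check. *)
Definition all_moments f := measurable_fun setT f /\
  forall k, P.-integrable setT (fun w => (`|f w| ^+ k)%:E).

Lemma all_moments_measurable f : all_moments f -> measurable_fun setT f.
Proof. by case. Qed.

Lemma all_moments_integrable f : all_moments f -> P.-integrable setT (EFin \o f).
Proof.
move=> [mf /(_ 1%N) h]; apply: le_integrable h => //; first exact/measurable_EFinP.
by move=> w _ /=; rewrite expr1 normr_id.
Qed.

Lemma all_moments_dominated f : measurable_fun setT f ->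
  (forall k, exists C, exists h, [/\ P.-integrable setT (EFin \o h) &
     forall w, `|f w| ^+ k <= C * h w]) -> all_moments f.
Proof.
move=> mf fh; split => // k; have [C [h [ih fC]]] := fh k.
apply: le_integrable (integrableZl measurableT C ih) => //.
  by apply/measurable_EFinP; apply: measurable_funX; exact: measurableT_comp.
move=> w _ /=; rewrite lee_fin ger0_norm ?exprn_ge0//.
by apply: le_trans (fC w) _; exact: ler_norm.
Qed.

Lemma all_moments_bounded f M : measurable_fun setT f ->
  (forall w, `|f w| <= M) -> all_moments f.
Proof.
move=> mf fM; apply: all_moments_dominated => // k.
exists (M ^+ k), (cst 1); split; first exact: finite_measure_integrable_cst.
by move=> w; rewrite /= mulr1 lerXn2r ?nnegrE// (le_trans _ (fM w)).
Qed.

Lemma all_moments_cst c : all_moments (fun=> c).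
Proof. by apply: (@all_moments_bounded _ `|c|) => //; exact: measurable_cst. Qed.

Lemma all_moments_abs f k : all_moments f -> P.-integrable setT (EFin \o (fun w => `|f w| ^+ k)).
Proof. by move=> [_]; apply. Qed.

Lemma all_momentsM f g : all_moments f -> all_moments g ->
  all_moments (fun w => f w * g w).
Proof.
move=> mf mg; apply: all_moments_dominated => [|k].
  by apply: measurable_funM; exact: all_moments_measurable.
exists 1, (fun w => `|f w| ^+ (k * 2) + `|g w| ^+ (k * 2)); split.
  by apply: eq_integrable (integrableD measurableT (all_moments_abs (k * 2) mf)
    (all_moments_abs (k * 2) mg)).
move=> w; rewrite normrM mul1r exprMn !exprM.
have := sqr_ge0 (`|f w| ^+ k - `|g w| ^+ k).
have := sqr_ge0 (`|f w| ^+ k); have := sqr_ge0 (`|g w| ^+ k); nra.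
Qed.

Lemma all_momentsD f g : all_moments f -> all_moments g ->
  all_moments (fun w => f w + g w).
Proof.
move=> mf mg; apply: all_moments_dominated => [|k].
  by apply: measurable_funD; exact: all_moments_measurable.
exists (2 ^+ k), (fun w => `|f w| ^+ k + `|g w| ^+ k); split.
  by apply: eq_integrable (integrableD measurableT (all_moments_abs k mf)
    (all_moments_abs k mg)).
move=> w; have h (a b : R) : 0 <= a -> a <= b -> (a + b) ^+ k <= 2 ^+ k * (a ^+ k + b ^+ k).
  move=> a0 ab; have b0 := le_trans a0 ab.
  apply: (@le_trans _ _ ((2 * b) ^+ k)).
    by rewrite lerXn2r ?nnegrE ?addr_ge0 ?mulr_ge0//; lra.
  by rewrite exprMn ler_wpM2l ?exprn_ge0// lerDr exprn_ge0.
apply: (@le_trans _ _ ((`|f w| + `|g w|) ^+ k)).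
  by rewrite lerXn2r ?nnegrE ?addr_ge0// ler_normD.
case/orP: (le_total `|f w| `|g w|) => fg; first exact: h.
by rewrite addrC [X in _ * X]addrC; exact: h.
Qed.

Lemma all_momentsZ c f : all_moments f -> all_moments (fun w => c * f w).
Proof. by move=> mf; apply: all_momentsM => //; exact: all_moments_cst. Qed.

Lemma all_momentsX k f : all_moments f -> all_moments (fun w => f w ^+ k).
Proof.
move=> mf; elim: k => [|k ih].
  by under eq_fun do rewrite expr0; exact: all_moments_cst.
by under eq_fun do rewrite exprS; exact: all_momentsM.
Qed.

Lemma all_moments_sum (I : Type) (r : seq I) (F : I -> T -> R) :
  (forall i, all_moments (F i)) -> all_moments (fun w => \sum_(i <- r) F i w).
Proof.
move=> mF; elim: r => [|i r ih].
  by under eq_fun do rewrite big_nil; exact: all_moments_cst.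
by under eq_fun do rewrite big_cons; exact: all_momentsD.
Qed.

Lemma all_moments_prod (I : Type) (r : seq I) (F : I -> T -> R) :
  (forall i, all_moments (F i)) -> all_moments (fun w => \prod_(i <- r) F i w).
Proof.
move=> mF; elim: r => [|i r ih].
  by under eq_fun do rewrite big_nil; exact: all_moments_cst.
by under eq_fun do rewrite big_cons; exact: all_momentsM.
Qed.

Lemma EFin_mean f : all_moments f -> ((mean f)%:E = \int[P]_w (f w)%:E)%E.
Proof.
by move=> mf; rewrite /mean /Rintegral fineK//; apply: integrable_fin_num => //;
  exact: all_moments_integrable.
Qed.

Lemma mean_ext f g : f =1 g -> mean f = mean g.
Proof. by move=> fg; congr mean; apply/funext. Qed.

Lemma meanD f g : all_moments f -> all_moments g ->
  mean (fun w => f w + g w) = mean f + mean g.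
Proof. by move=> mf mg; apply: RintegralD => //; exact: all_moments_integrable. Qed.

Lemma meanZ c f : all_moments f -> mean (fun w => c * f w) = c * mean f.
Proof. by move=> mf; apply: RintegralZl => //; exact: all_moments_integrable. Qed.

Lemma mean_cst c : mean (fun=> c) = c.
Proof. by rewrite /mean /Rintegral integral_cst//= probability_setT mule1. Qed.

Lemma mean_sum (I : Type) (r : seq I) (F : I -> T -> R) :
  (forall i, all_moments (F i)) ->
  mean (fun w => \sum_(i <- r) F i w) = \sum_(i <- r) mean (F i).
Proof.
move=> mF; elim: r => [|i r ih].
  by rewrite big_nil -[RHS]mean_cst; apply: mean_ext => w; rewrite big_nil.
rewrite big_cons -ih -meanD//; last exact: all_moments_sum.
by apply: mean_ext => w; rewrite big_cons.
Qed.

Lemma mean_ge0 f : (forall w, 0 <= f w) -> 0 <= mean f.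
Proof. by move=> f0; apply: Rintegral_ge0. Qed.

End AllMoments.

(** * Centered Gaussian variables *)

Section CenteredGaussian.
Import numFieldNormedType.Exports.
Context {d : measure_display} {T : measurableType d} {R : realType}.
Variable P : probability T R.
Implicit Types Y : T -> R.
Local Notation mean := (mean P).
Local Notation all_moments := (all_moments P).

Definition gaussian Y :=
  (exists s : R, s != 0 /\
       forall A : set R, measurable A -> P (Y @^-1` A) = normal_prob 0 s A)
    \/ P [set w | Y w = 0] = 1%E.

(** The property of Gaussian variables on which completeness of polynomials rests. Leaving [c]
    existential covers the degenerate case as well. *)
Definition exp_square_integrable Y := measurable_fun setT Y /\
  exists2 c, 0 < c & P.-integrable setT (fun w => (expR (c * Y w ^+ 2))%:E).

(* [normal_prob] is a measure on [measurableTypeR R], whose measurable sets are those of [R]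
   under another display; hence the casts. *)
Lemma ge0_integral_gaussian_law Y s (f : R -> \bar R) : measurable_fun setT Y ->
  (forall A : set R, measurable A -> P (Y @^-1` A) = normal_prob 0 s A) ->
  measurable_fun [set: R] f -> (forall x, 0 <= f x)%E ->
  (\int[P]_w f (Y w) = \int[normal_prob 0 s]_x f x)%E.
Proof.
move=> mY law mf f0.
have mY1 : measurable_fun setT (Y : T -> measurableTypeR R) by exact: mY.
have mf1 : measurable_fun [set: measurableTypeR R] f by exact: mf.
pose mY' := isMeasurableFun.Build _ _ _ _ _ mY1.
pose Y' : {mfun T >-> measurableTypeR R} := HB.pack (Y : T -> measurableTypeR R) mY'.
rewrite -[LHS](ge0_integral_distribution Y' mf1 f0).
by apply: eq_measure_integral => A mA _; exact: law.
Qed.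

Lemma integral_gaussian_law Y s (f : R -> \bar R) : measurable_fun setT Y ->
  (forall A : set R, measurable A -> P (Y @^-1` A) = normal_prob 0 s A) ->
  measurable_fun [set: R] f -> P.-integrable setT (f \o Y) ->
  (\int[P]_w f (Y w) = \int[normal_prob 0 s]_x f x)%E.
Proof.
move=> mY law mf fi.
have mY1 : measurable_fun setT (Y : T -> measurableTypeR R) by exact: mY.
have mf1 : measurable_fun [set: measurableTypeR R] f by exact: mf.
pose mY' := isMeasurableFun.Build _ _ _ _ _ mY1.
pose Y' : {mfun T >-> measurableTypeR R} := HB.pack (Y : T -> measurableTypeR R) mY'.
rewrite -[LHS](@integral_distribution _ _ _ _ _ P Y' _ mf1 fi).
by apply: eq_measure_integral => A mA _; exact: law.
Qed.

Lemma ge0_integral_null_law Y (f : R -> \bar R) : measurable_fun setT Y ->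
  P [set w | Y w = 0] = 1%E ->
  measurable_fun [set: R] f -> 
  (\int[P]_w f (Y w) = f 0%R)%E.
Proof.
move=> mY Y0 mf.
have m0 : measurable [set w | Y w = 0].
  by rewrite -[X in measurable X]setTI; exact: (mY measurableT [set 0]).
transitivity (\int[P]_w (cst (f 0%R) w))%E.
  apply: ae_eq_integral => //; first exact: measurableT_comp.
  exists (~` [set w | Y w = 0]); split; first exact: measurableC.
    by apply: etrans (probability_setC P m0) _; rewrite Y0 subee.
  by move=> w /= h Yw; apply: h => _; rewrite Yw.
by rewrite integral_cst//= probability_setT mule1.
Qed.

Lemma gaussian_exp_square Y : measurable_fun setT Y -> gaussian Y ->
  exp_square_integrable Y.
Proof.
move=> mY gY; split => //.
have me c : measurable_fun [set: R] (fun x => (expR (c * x ^+ 2))%:E).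
  by apply/measurable_EFinP; apply: measurableT_comp => //; exact: measurable_funM.
have e0 (c x : R) : (0 <= (expR (c * x ^+ 2))%:E)%E by rewrite lee_fin expR_ge0.
have int c : (\int[P]_w (expR (c * Y w ^+ 2))%:E < +oo)%E ->
    P.-integrable setT (fun w => (expR (c * Y w ^+ 2))%:E).
  move=> h; apply/integrableP; split; first exact: (measurableT_comp (me c)).
  by under eq_integral do rewrite gee0_abs//.
case: gY => [[s [s0 law]]|Y0].
  exists (3 / (8 * s ^+ 2)).
    by apply: divr_gt0 => //; apply: mulr_gt0 => //; rewrite exprn_even_gt0.
  apply: int; rewrite (ge0_integral_gaussian_law mY law (me _) (e0 _)).
  by rewrite integral_normal_expsq// ltry.
exists 1 => //; apply: int.
by rewrite (ge0_integral_null_law mY Y0 (me 1)) ltry.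
Qed.

Lemma exp_square_all_moments Y : exp_square_integrable Y -> all_moments Y.
Proof.
move=> [mY [c c0 ie]]; apply: all_moments_dominated mY _ => k.
exists (1 + k`!%:R / c ^+ k), (fun w => expR (c * Y w ^+ 2)); split => // w.
have h1 : 1 <= expR (c * Y w ^+ 2).
  by rewrite -[leLHS]expR0 ler_expR mulr_ge0 ?sqr_ge0// ltW.
have h2 := expr_le_expR (Y w) k c0.
have h3 : `|Y w| ^+ k <= 1 + Y w ^+ (2 * k).
  rewrite mulnC exprM -normrX.
  have := sqr_ge0 (`|Y w ^+ k| - 1); rewrite -(real_normK (num_real (Y w ^+ k))).
  have := sqr_ge0 (`|Y w ^+ k|); nra.
by rewrite mulrDl mul1r (le_trans h3)// lerD.
Qed.

Lemma gaussian_moment_even Y k : measurable_fun setT Y -> gaussian Y ->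
  mean (fun w => Y w ^+ (2 * k.+1)) =
  (2 * k).+1%:R * mean (fun w => Y w ^+ 2) * mean (fun w => Y w ^+ (2 * k)).
Proof.
move=> mY gY.
have mX j : all_moments (fun w => Y w ^+ j).
  by apply: all_momentsX; apply: exp_square_all_moments; exact: gaussian_exp_square.
have mp j : measurable_fun [set: R] (fun x => (x ^+ j)%:E) by exact/measurable_EFinP.
have p0 j (x : R) : (0 <= (x ^+ (2 * j))%:E)%E by rewrite lee_fin exprn_even_ge0// oddM.
(* The factor is [s^2] for a proper Gaussian and 0 for a null variable; in both cases the recursion
   at [j = 0] identifies it with the second moment. *)
suff [t e] : exists t, forall j, mean (fun w => Y w ^+ (2 * j.+1)) =
    (2 * j).+1%:R * t * mean (fun w => Y w ^+ (2 * j)).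
  have := e 0%N; rewrite muln0 muln1.
  rewrite (_ : mean (fun w => Y w ^+ 0) = 1); last first.
    by rewrite -[RHS](mean_cst P); apply: mean_ext => w; rewrite expr0.
  by rewrite mul1r mulr1 => ->; exact: e.
case: gY => [[s [s0 law]]|Y0].
  exists (s ^+ 2) => j; apply: EFin_inj; rewrite EFinM !EFin_mean//.
  rewrite (ge0_integral_gaussian_law mY law (mp _) (p0 _)).
  by rewrite (ge0_integral_gaussian_law mY law (mp _) (p0 _)) integral_normal_momentS.
exists 0 => j; rewrite mulr0 mul0r; apply: EFin_inj; rewrite EFin_mean//.
by rewrite (ge0_integral_null_law mY Y0 (mp _)) expr0n.
Qed.

(* [- Y] has the same variance, hence the same law, as [Y]. *)
Lemma gaussian_moment_odd Y k : measurable_fun setT Y -> gaussian Y ->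
  gaussian (fun w => - Y w) -> odd k -> mean (fun w => Y w ^+ k) = 0.
Proof.
move=> mY gY gNY ok.
have mNY : measurable_fun setT (fun w => - Y w) by exact: measurableT_comp.
have mX j : all_moments (fun w => Y w ^+ j).
  by apply: all_momentsX; apply: exp_square_all_moments; exact: gaussian_exp_square.
have mNX j : all_moments (fun w => (- Y w) ^+ j).
  by apply: all_momentsX; apply: exp_square_all_moments; exact: gaussian_exp_square.
have mp j : measurable_fun [set: R] (fun x => (x ^+ j)%:E) by exact/measurable_EFinP.
have null : P [set w | Y w = 0] = 1%E -> mean (fun w => Y w ^+ k) = 0.
  move=> Y0; apply: EFin_inj; rewrite EFin_mean//.
  by rewrite (ge0_integral_null_law mY Y0 (mp _)) expr0n; case: k ok.
case: gY => [[s [s0 law]]|//].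
case: gNY => [[t [t0 lawN]]|NY0]; last first.
  apply: null; rewrite -NY0; congr (P _); apply/seteqP; split => w /=; first by move=> ->; rewrite oppr0.
  by move/eqP; rewrite oppr_eq0 => /eqP.
have p2 (x : R) : (0 <= (x ^+ 2)%:E)%E by rewrite lee_fin sqr_ge0.
have st : s ^+ 2 = t ^+ 2.
  apply: EFin_inj; rewrite -(integral_normal_sqr s0) -(integral_normal_sqr t0).
  rewrite -(ge0_integral_gaussian_law mY law (mp _) p2).
  rewrite -(ge0_integral_gaussian_law mNY lawN (mp _) p2).
  by apply: eq_integral => w _; rewrite sqrrN.
have {}lawN A : measurable A -> P ((fun w => - Y w) @^-1` A) = normal_prob 0 s A.
  move=> mA; rewrite lawN// /normal_prob; apply: eq_integral => x _.
  by rewrite !normal_pdfE// /normal_peak /normal_fun st.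
have : mean (fun w => Y w ^+ k) = mean (fun w => (- Y w) ^+ k).
  apply: EFin_inj; rewrite !EFin_mean//.
  have i1 := all_moments_integrable (mX k).
  have i2 := all_moments_integrable (mNX k).
  by rewrite (integral_gaussian_law mY law (mp _) i1)
    (integral_gaussian_law mNY lawN (mp _) i2).
rewrite [X in _ = X -> _](_ : _ = - mean (fun w => Y w ^+ k)); first by lra.
rewrite -mulN1r -meanZ//; apply: mean_ext => w.
by rewrite exprNn -signr_odd ok expr1.
Qed.

End CenteredGaussian.

(** * Wick's formula *)

Section PolynomialJet.
Import numFieldNormedType.Exports.
Context {R : realType}.
Implicit Types (h : R -> R) (c : R).

(* [h] is a polynomial function whose two lowest coefficients are [c0] and [c1]. *)
Definition poly_jet h c0 c1 := exists p : {poly R},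
  [/\ forall x, h x = p.[x], p`_0 = c0 & p`_1 = c1].

(** Polynomials that agree as functions agree as polynomials: a nonzero difference cannot vanish at
    as many integers as its size. This allows comparison of the coefficients of [x] in two
    expressions for the same mean. *)
Lemma poly_jet_inj h c0 c1 c0' c1' :
  poly_jet h c0 c1 -> poly_jet h c0' c1' -> c1 = c1'.
Proof.
move=> [p [hp _ <-]] [q [hq _ <-]]; suff -> : p = q by [].
apply/eqP; rewrite -subr_eq0; apply/negPn/negP => pq0.
pose s : seq R := [seq i%:R | i <- iota 0 (size (p - q))].
have := max_poly_roots pq0 (rs := s).
have -> : all (root (p - q)) s.
  by apply/allP => x _; rewrite /root hornerD hornerN -hp -hq subrr.
have -> : uniq s by rewrite map_inj_uniq ?iota_uniq//; exact: mulrIn (oner_neq0 R).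
by rewrite size_map size_iota ltnn => /(_ isT isT).
Qed.

Lemma poly_jet_ext h h' c0 c1 c0' c1' : h =1 h' -> c0 = c0' -> c1 = c1' ->
  poly_jet h c0 c1 -> poly_jet h' c0' c1'.
Proof. by move=> hh' <- <- [p [hp ? ?]]; exists p; split=> // x; rewrite -hh'. Qed.

Lemma poly_jet_eq h' h c0 c1 : poly_jet h c0 c1 -> h =1 h' -> poly_jet h' c0 c1.
Proof. by move=> hj hh'; exact: poly_jet_ext hj. Qed.

Lemma poly_jet_cst c : poly_jet (fun=> c) c 0.
Proof. by exists c%:P; split => [x||]; rewrite ?hornerC ?coefC. Qed.

Lemma poly_jet_id : poly_jet id 0 1.
Proof. by exists 'X; split => [x||]; rewrite ?hornerX ?coefX. Qed.

Lemma poly_jetD h h' c0 c1 c0' c1' : poly_jet h c0 c1 -> poly_jet h' c0' c1' ->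
  poly_jet (fun x => h x + h' x) (c0 + c0') (c1 + c1').
Proof.
move=> [p [hp <- <-]] [q [hq <- <-]]; exists (p + q).
by split => [x||]; rewrite ?hornerD ?coefD ?hp ?hq.
Qed.

Lemma poly_jetM h h' c0 c1 c0' c1' : poly_jet h c0 c1 -> poly_jet h' c0' c1' ->
  poly_jet (fun x => h x * h' x) (c0 * c0') (c1 * c0' + c0 * c1').
Proof.
move=> [p [hp <- <-]] [q [hq <- <-]]; exists (p * q).
split => [x||]; rewrite ?hornerM ?hp ?hq// coefM ?big_ord1//.
by rewrite !big_ord_recl big_ord0 addr0 /= addrC.
Qed.

Lemma poly_jetZ k h c0 c1 : poly_jet h c0 c1 ->
  poly_jet (fun x => k * h x) (k * c0) (k * c1).
Proof.
move=> hj; apply: poly_jet_ext (poly_jetM (poly_jet_cst k) hj) => //.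
by rewrite mul0r add0r.
Qed.

Lemma poly_jet_affine a b : poly_jet (fun x => a + x * b) a b.
Proof.
apply: poly_jet_ext (poly_jetD (poly_jet_cst a) (poly_jetM poly_jet_id (poly_jet_cst b))).
- by [].
- by rewrite mul0r addr0.
- by rewrite mul1r mulr0 addr0 add0r.
Qed.
End PolynomialJet.

(** * Polarization of one-dimensional moments *)

Section Wick.
Import numFieldNormedType.Exports.
Context {d : measure_display} {T : measurableType d} {R : realType}.
Variable P : probability T R.
Variables (n : nat) (X : 'I_n -> T -> R).
Hypothesis mX : forall i, measurable_fun setT (X i).
Hypothesis gX : centered_gaussian_vector P X.
Implicit Types (a b y : 'I_n -> R) (k : nat).
Local Notation mean := (mean P).
Local Notation all_moments := (all_moments P).

(** Induction on [k] moves one factor [V + x Y] at a time into [D], which avoids the full binomial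
    expansion. At [k = 0] the truncated exponent is harmless, since its coefficient is 0. *)
Lemma poly_jet_mean (D V Y : T -> R) k :
  all_moments D -> all_moments V -> all_moments Y ->
  poly_jet (fun x => mean (fun w => D w * (V w + x * Y w) ^+ k))
    (mean (fun w => D w * V w ^+ k))
    (k%:R * mean (fun w => D w * V w ^+ k.-1 * Y w)).
Proof.
move=> mD mV mY; elim: k D mD => [|k ih] D mD.
  apply: poly_jet_ext (poly_jet_cst (mean D)) => [x||].
  - by apply: mean_ext => w; rewrite expr0 mulr1.
  - by apply: mean_ext => w; rewrite expr0 mulr1.
  - by rewrite mul0r.
have mVY x : all_moments (fun w => V w + x * Y w).
  by apply: all_momentsD => //; exact: all_momentsZ.
have mDV := all_momentsM mD mV; have mDY := all_momentsM mD mY.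
apply: poly_jet_ext (poly_jetD (ih _ mDV) (poly_jetM poly_jet_id (ih _ mDY))).
- move=> x; rewrite -meanZ; last by apply: all_momentsM => //; exact: all_momentsX.
  rewrite -meanD; last 2 first.
  + by apply: all_momentsM => //; exact: all_momentsX.
  + by apply: all_momentsZ; apply: all_momentsM => //; exact: all_momentsX.
  by apply: mean_ext => w; rewrite exprS; ring.
- by rewrite mul0r addr0; apply: mean_ext => w; rewrite exprS mulrA.
- rewrite mul0r addr0 mul1r /= -nat1r mulrDl mul1r addrC; congr (_ + _).
    by apply: mean_ext => w; rewrite mulrAC.
  case: k {ih} => [|k]; first by rewrite !mul0r.
  by congr (_ * _); apply: mean_ext => w; rewrite exprS; ring.
Qed.

Definition lin a w := \sum_(i < n) a i * X i w.

Lemma linD a b x w : lin (fun i => a i + x * b i) w = lin a w + x * lin b w.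
Proof.
rewrite /lin mulr_sumr -big_split/=; apply: eq_bigr => i _.
by rewrite mulrDl mulrA.
Qed.

Lemma linN a w : lin (fun i => - a i) w = - lin a w.
Proof. by rewrite /lin -sumrN; apply: eq_bigr => i _; rewrite mulNr. Qed.

Lemma measurable_lin a : measurable_fun setT (lin a).
Proof. by apply: measurable_sum => i; exact: measurable_funM. Qed.

Lemma gaussian_lin a : gaussian P (lin a).
Proof. exact: gX. Qed.

Lemma exp_square_lin a : exp_square_integrable P (lin a).
Proof. exact: gaussian_exp_square (measurable_lin a) (gaussian_lin a). Qed.

Lemma all_moments_lin a : all_moments (lin a).
Proof. exact: exp_square_all_moments (exp_square_lin a). Qed.
Hint Resolve all_moments_lin : core.

Definition cov a b := mean (fun w => lin a w * lin b w).

Lemma covC a b : cov a b = cov b a.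
Proof. by apply: mean_ext => w; rewrite mulrC. Qed.

Lemma covDl a b x y : cov (fun i => a i + x * b i) y = cov a y + x * cov b y.
Proof.
rewrite /cov -meanZ; last exact: all_momentsM.
rewrite -meanD; [|exact: all_momentsM|by apply: all_momentsZ; exact: all_momentsM].
by apply: mean_ext => w; rewrite linD mulrDl mulrA.
Qed.

Lemma covDr a b x y : cov y (fun i => a i + x * b i) = cov y a + x * cov y b.
Proof. by rewrite covC covDl !(covC y). Qed.

Lemma mean_linX_odd a k : odd k -> mean (fun w => lin a w ^+ k) = 0.
Proof.
apply: gaussian_moment_odd; [exact: measurable_lin|exact: gaussian_lin|].
have -> : (fun w => - lin a w) = lin (fun i => - a i).
  by apply/funext => w; rewrite linN.
exact: gaussian_lin.
Qed.

(** Even and odd moments in one formula. If [k.+1] is odd, both sides vanish, for [k = 0] because of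
    the factor [k%:R]. *)
Lemma mean_lin_recursion a k : mean (fun w => lin a w ^+ k.+1) =
  k%:R * cov a a * mean (fun w => lin a w ^+ k.-1).
Proof.
have [ok|ek] := boolP (odd k.+1).
  rewrite mean_linX_odd//; case: k ok => [|k] ok; first by rewrite !mul0r.
  by rewrite [X in _ * X]mean_linX_odd ?mulr0//=; move: ok => /=; rewrite !negbK.
have [j kj] : exists j, k = (2 * j).+1.
  exists k./2; move: ek; rewrite /= negbK => ek.
  by rewrite -[LHS]odd_double_half ek add1n -muln2 mulnC.
rewrite {}kj /= (_ : (2 * j).+2 = (2 * j.+1)%N); last by rewrite mulnS add2n.
rewrite (gaussian_moment_even _ (measurable_lin a) (gaussian_lin a)).
by congr (_ * _ * _); apply: mean_ext => w; rewrite expr2.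
Qed.

Lemma all_moments_linX a k : all_moments (fun w => lin a w ^+ k).
Proof. exact: all_momentsX. Qed.

(** The coefficient of [x] in the moment recursion for [a + x b]. On the right, the variance
    contributes [2 cov a b], and the lower moment contributes a mean of the same kind with exponent
    smaller by two, known by induction. *)
Lemma mean_lin_linX b a k : mean (fun w => lin b w * lin a w ^+ k) =
  k%:R * cov a b * mean (fun w => lin a w ^+ k.-1).
Proof.
elim/ltn_ind: k => -[|[|k]] ih.
- rewrite !mul0r -(mean_linX_odd b (isT : odd 1)).
  by apply: mean_ext => w; rewrite mulr1 expr1.
- rewrite mul1r (_ : mean (fun w => lin a w ^+ 1.-1) = 1).
    by rewrite mulr1 covC; apply: mean_ext => w; rewrite expr1.
  by rewrite -[RHS](mean_cst P); apply: mean_ext => w; rewrite expr0.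
have m1 := all_moments_cst P 1.
have L := poly_jet_mean k.+3 m1 (all_moments_lin a) (all_moments_lin b).
have Q := poly_jet_mean k.+1 m1 (all_moments_lin a) (all_moments_lin b).
have C : poly_jet (fun x => (cov a a + x * cov a b) + x * (cov b a + x * cov b b))
    (cov a a) (2 * cov a b).
  apply: poly_jet_ext (poly_jetD (poly_jet_affine (cov a a) (cov a b))
    (poly_jetM poly_jet_id (poly_jet_affine (cov b a) (cov b b)))) => //.
  + by rewrite mul0r addr0.
  + by rewrite (covC b a); ring.
have {}Q := poly_jetZ k.+2%:R (poly_jetM C Q).
unshelve epose proof (poly_jet_eq
  (h' := fun x => mean (fun w => 1 * (lin a w + x * lin b w) ^+ k.+3)) Q _) as Q'.
  move=> x /=.
  have := mean_lin_recursion (fun i => a i + x * b i) k.+2.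
  rewrite covDl !covDr /= => e.
  rewrite [RHS](_ : _ = mean (fun w => lin (fun i => a i + x * b i) w ^+ k.+3)).
    rewrite e -mulrA; congr (_ * (_ * _)); apply: mean_ext => w.
    by rewrite linD mul1r.
  by apply: mean_ext => w; rewrite linD mul1r.
have := poly_jet_inj L Q'.
rewrite (_ : mean (fun w => 1 * lin a w ^+ k.+1.-1 * lin b w) =
    mean (fun w => lin b w * lin a w ^+ k)); last first.
  by apply: mean_ext => w; rewrite mul1r mulrC.
rewrite (_ : mean (fun w => 1 * lin a w ^+ k.+3.-1 * lin b w) =
    mean (fun w => lin b w * lin a w ^+ k.+2)); last first.
  by apply: mean_ext => w; rewrite mul1r mulrC.
rewrite (_ : mean (fun w => 1 * lin a w ^+ k.+1) = mean (fun w => lin a w ^+ k.+1)); last first.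
  by apply: mean_ext => w; rewrite mul1r.
rewrite (ih k)//=.
have := mean_lin_recursion a k.
set g := mean (fun w => lin a w ^+ k.+1); set g' := mean _ => gg'.
(* By the recursion [g] equals [k cov(a,a) g'], so the bracket becomes [(k + 3) g] and the factor
   [k + 3] cancels. *)
have -> : 2 * cov a b * g + cov a a * (k.+1%:R * (k%:R * cov a b * g')) =
   cov a b * (2 * g + k.+1%:R * (k%:R * cov a a * g')) by ring.
rewrite -gg' => e.
have k3 : k.+3%:R != 0 :> R by rewrite pnatr_eq0.
apply: (mulfI k3); rewrite e -(natr1 k.+2) -(natr1 k.+1) -(natr1 k); ring.
Qed.

Definition linprod (ys : seq ('I_n -> R)) w := \prod_(y <- ys) lin y w.

(* The sum over the pairings of [b] with one factor of [ys], where [F] is applied to the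
   remaining factors. *)
Fixpoint contract (F : seq ('I_n -> R) -> R) b ys :=
  if ys is y :: ys' then cov b y * F ys' + contract (fun l => F (y :: l)) b ys'
  else 0.

Lemma contractZ (F : seq ('I_n -> R) -> R) c b ys :
  contract (fun l => c * F l) b ys = c * contract F b ys.
Proof.
elim: ys F => [|y ys ih] F /=; first by rewrite mulr0.
by rewrite (ih (fun l => F (y :: l))) mulrDr mulrCA.
Qed.

Lemma eq_contract (F G : seq ('I_n -> R) -> R) b ys : F =1 G ->
  contract F b ys = contract G b ys.
Proof.
elim: ys F G => [//|y ys ih] F G FG /=; rewrite FG; congr (_ + _).
by apply: ih => l; rewrite FG.
Qed.

Lemma poly_jet_contract (F : R -> seq ('I_n -> R) -> R) F0 F1 b ys :
  (forall l, poly_jet (F^~ l) (F0 l) (F1 l)) ->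
  poly_jet (fun x => contract (F x) b ys) (contract F0 b ys) (contract F1 b ys).
Proof.
elim: ys F F0 F1 => [|y ys ih] F F0 F1 FJ /=; first exact: poly_jet_cst.
apply: poly_jetD; first exact: poly_jetZ.
by apply: (ih (fun x l => F x (y :: l))) => l; exact: FJ.
Qed.

Lemma all_moments_linprod ys : all_moments (linprod ys).
Proof. exact: all_moments_prod. Qed.
Hint Resolve all_moments_linprod all_moments_linX all_momentsM : core.

Lemma linprod_cons y ys w : linprod (y :: ys) w = lin y w * linprod ys w.
Proof. by rewrite /linprod big_cons. Qed.

(* Polarization: replacing [a] by [a + x y] and comparing the coefficients of
   [x] moves one factor from the power into the product. *)
Lemma wick b a k ys :
  mean (fun w => lin b w * lin a w ^+ k * linprod ys w) =
  k%:R * cov a b * mean (fun w => lin a w ^+ k.-1 * linprod ys w) +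
  contract (fun l => mean (fun w => lin a w ^+ k * linprod l w)) b ys.
Proof.
elim: ys a k => [|y ys ih] a k.
  rewrite addr0 (_ : mean (fun w => _ ^+ k.-1 * _) = mean (fun w => lin a w ^+ k.-1)).
    rewrite -mean_lin_linX; apply: mean_ext => w.
    by rewrite /linprod big_nil mulr1.
  by apply: mean_ext => w; rewrite /linprod big_nil mulr1.
have J D j (mD : all_moments D) := poly_jet_mean j mD (all_moments_lin a) (all_moments_lin y).
(* The exponent is raised to [k + 1] because taking the coefficient of [x] lowers it by one; the
   factor [k + 1] that appears on both sides is cancelled afterwards. *)
have L := J (fun w => lin b w * linprod ys w) k.+1
  (all_momentsM (all_moments_lin b) (all_moments_linprod ys)).
have Q1 := poly_jetZ k.+1%:R (poly_jetM (poly_jet_affine (cov a b) (cov y b))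
  (J _ k (all_moments_linprod ys))).
have Q2 := @poly_jet_contract _ _ _ b ys (fun l => J _ k.+1 (all_moments_linprod l)).
unshelve epose proof (poly_jet_eq
  (h' := fun x => mean (fun w => lin b w * linprod ys w * (lin a w + x * lin y w) ^+ k.+1))
  (poly_jetD Q1 Q2) _) as Q.
  move=> x /=.
  have := ih (fun i => a i + x * y i) k.+1.
  rewrite covDl /= => e.
  rewrite [RHS](_ : _ = mean (fun w => lin b w * lin (fun i => a i + x * y i) w ^+ k.+1 * linprod ys w)).
    rewrite e mulrA; congr (_ * _ + _).
      by apply: mean_ext => w; rewrite linD mulrC.
    by apply: eq_contract => l; apply: mean_ext => w; rewrite linD mulrC.
  by apply: mean_ext => w; rewrite linD mulrAC.
have := poly_jet_inj L Q.
rewrite contractZ -mulrDr => /(mulfI (_ : k.+1%:R != 0)) /=; rewrite pnatr_eq0 => /(_ isT) e.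
rewrite [LHS](_ : _ = mean (fun w => lin b w * linprod ys w * lin a w ^+ k * lin y w)); last first.
  by apply: mean_ext => w; rewrite linprod_cons; ring.
rewrite e addrAC addrC; congr (_ + _); last first.
  rewrite covC; congr (_ * _ + _); first by apply: mean_ext => w; rewrite mulrC.
  by apply: eq_contract => l; apply: mean_ext => w; rewrite linprod_cons; ring.
rewrite mulrCA mulrA; congr (_ * _); apply: mean_ext => w.
by rewrite linprod_cons; ring.
Qed.
End Wick.

(** * The moment weighted by an even power of a normalized variable *)

Section Formula.
Import numFieldNormedType.Exports.
Context {d : measure_display} {T : measurableType d} {R : realType}.
Variable P : probability T R.
Variables (n : nat) (X : 'I_n -> T -> R).
Hypothesis mX : forall i, measurable_fun setT (X i).
Hypothesis gX : centered_gaussian_vector P X.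
Local Notation mean := (mean P).
Local Notation lin := (lin X).
Local Notation linprod := (linprod X).
Local Notation cov := (cov P X).

(** Pairing [2j] of the six factors with [v] produces [u (u-1) ... (u-2j+1)] times the moment of
    order [u - 2j]; the moment recursion turns this into [u (u-2) ... (u-2j+2)] times the moment of
    order [u]. This is the origin of the coefficients of [tilted_moment]. *)
Lemma mean_tilted m (v x y z : 'I_n -> R) : (0 < m)%N -> cov v v = 1 ->
  mean (fun w => lin v w ^+ (2 * m) * linprod [:: x; x; y; y; z; z] w) =
  mean (fun w => lin v w ^+ (2 * m)) *
  tilted_moment (2 * m)%:R (cov v x) (cov v y) (cov v z)
    (cov x x) (cov y y) (cov z z) (cov y z) (cov x z) (cov x y).
Proof.
move=> m0 v1.
pose M k l := mean (fun w => lin v w ^+ k * linprod l w).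
have Mcons k b l : M k (b :: l) = k%:R * cov v b * M k.-1 l + contract P X (M k) b l.
  rewrite /M -(wick mX gX); apply: mean_ext => w.
  by rewrite linprod_cons; ring.
pose g k := mean (fun w => lin v w ^+ k).
have Mnil k : M k [::] = g k.
  by apply: mean_ext => w; rewrite /linprod big_nil mulr1.
have gS k : g k.+1 = k%:R * g k.-1.
  by rewrite /g (mean_lin_recursion mX gX) v1 mulr1.
rewrite -/(M _ _) -/(g _).
do 6 rewrite ?Mcons /=.
rewrite !Mnil /tilted_moment.
(* For [m >= 3] all moments are reduced to the lowest one, of order [2m - 6]. The cases [m = 1] and
   [m = 2] are separate because this order is then truncated to 0. *)
case: m m0 => [//|[|[|m]]] _.
- by rewrite !muln1 /= !gS /=; ring.
- by rewrite (_ : (2 * 2 = 4)%N)//= !gS /=; ring.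
rewrite (_ : (2 * m.+3 = (2 * m).+2.+4)%N); last by rewrite !mulnS.
rewrite /= !(gS (2 * m).+2.+3) /= !(gS (2 * m).+3) /= !(gS (2 * m).+1) /=.
rewrite -(natr1 (2 * m).+2.+3) -(natr1 (2 * m).+2.+2) -(natr1 (2 * m).+3)
  -(natr1 (2 * m).+2) -(natr1 (2 * m).+1) -(natr1 (2 * m)).
by ring.
Qed.
End Formula.

(** * Completeness of polynomials *)

Section Sharpening.
Import numFieldNormedType.Exports.
Context {R : realType}.
Implicit Types (x z : R) (n N : nat).

Lemma expR_partial_sum_le x n : 0 <= x -> series (exp_coeff x) n <= expR x.
Proof.
move=> x0; apply: nondecreasing_cvgn_le; last exact: is_cvg_series_exp_coeff.
by apply: nondecreasing_series => i _ _; exact: exp_coeff_ge0.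
Qed.

Lemma norm_expR_partial_sum_le x n : `|series (exp_coeff x) n| <= expR `|x|.
Proof.
apply: le_trans (expR_partial_sum_le n (normr_ge0 x)).
apply: le_trans (ler_norm_sum _ _ _) _; apply: ler_sum => i _.
by rewrite /exp_coeff/= normrM normrX normfV [`|_%:R|]ger0_norm.
Qed.

Lemma bernoulli_le z N : 0 <= z <= 1 -> 1 - N%:R * z <= (1 - z) ^+ N.
Proof.
move=> /andP[z0 z1]; elim: N => [|N ih]; first by rewrite mul0r subr0.
apply: (@le_trans _ _ ((1 - z) * (1 - N%:R * z))).
  have : 0 <= N%:R * z ^+ 2 by rewrite mulr_ge0 ?sqr_ge0.
  by rewrite -natr1; lra.
by rewrite exprS ler_wpM2l// subr_ge0.
Qed.

(** Each of the [n] terms of the geometric sum is at least [x^n]. *)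
Lemma nat_expr_le x n : 0 <= x < 1 -> n%:R * x ^+ n <= (1 - x)^-1.
Proof.
move=> /andP[x0 x1]; have x1' : 0 < 1 - x by rewrite subr_gt0.
rewrite -(ler_pM2r x1') mulVf ?gt_eqF//.
apply: (@le_trans _ _ ((\sum_(i < n) x ^+ i) * (1 - x))).
  rewrite ler_pM2r// mulrC mulr_natr -[in leLHS](card_ord n) -sumr_const.
  apply: ler_sum => i _; apply: ler_wiXn2l => //; first exact: ltW.
  by rewrite card_ord ltnW.
have := subrX1 x n; have := exprn_ge0 n x0.
by set s := \sum_(i < n) _; nra.
Qed.

(* The factor [n] in the exponent makes the limit vanish at [x = 1/2] as well. *)
Definition sharpening n x := (1 - x ^+ (2 * n)) ^+ (n * 4 ^ n).

Lemma sharpening_ge0_le1 n x : 0 <= x <= 1 -> 0 <= sharpening n x <= 1.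
Proof.
move=> /andP[x0 x1].
have h : 0 <= x ^+ (2 * n) <= 1 by rewrite exprn_ge0//= exprn_ile1.
by rewrite /sharpening exprn_ge0 ?exprn_ile1//=; lra.
Qed.

(** Bernoulli's inequality bounds the defect by [n (2x)^(2n)]; one factor [(2x)^n] absorbs [n], the
    other tends to 0. *)
Lemma sharpening_cvg1 x : 0 <= x -> x < 2^-1 -> sharpening n x @[n --> \oo] --> (1 : R).
Proof.
move=> x0 x2; have x1 : x <= 1 by lra.
apply: (@squeeze_cvgr _ _ _ _ (fun n => 1 - (1 - 2 * x)^-1 * (2 * x) ^+ n) (fun=> 1)).
- apply: nearW => n; have /andP[_ ->] := sharpening_ge0_le1 n (introT andP (conj x0 x1)).
  rewrite andbT; apply: le_trans (bernoulli_le (n * 4 ^ n) _); last first.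
    by rewrite exprn_ge0//= exprn_ile1.
  rewrite lerD2l lerN2.
  have -> : (n * 4 ^ n)%:R * x ^+ (2 * n) = n%:R * (2 * x) ^+ n * (2 * x) ^+ n.
    rewrite natrM natrX -!mulrA -exprD addnn -mul2n; congr (_ * _).
    by rewrite !(exprM _ 2) -exprMn; congr (_ ^+ n); ring.
  by apply: ler_wpM2r; [rewrite exprn_ge0// mulr_ge0|apply: nat_expr_le; lra].
- rewrite -[X in _ --> X]subr0; apply: cvgB; first exact: cvg_cst.
  rewrite -[X in _ --> X](mulr0 (1 - 2 * x)^-1); apply: cvgM; first exact: cvg_cst.
  by apply: cvg_expr; rewrite ger0_norm ?mulr_ge0//; lra.
- exact: cvg_cst.
Qed.

(** From [1 - t <= exp(-t)] comes the bound [exp(-n (2x)^(2n))], which is at most [exp(-n)] and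
    hence at most [1/(n+1)]. *)
Lemma sharpening_cvg0 x : x <= 1 -> 2^-1 <= x -> sharpening n x @[n --> \oo] --> (0 : R).
Proof.
move=> x1 x2; have x0 : 0 <= x by lra.
apply: (@squeeze_cvgr _ _ _ _ (fun=> 0) (@harmonic R)).
- apply: nearW => n; have /andP[-> _] := sharpening_ge0_le1 n (introT andP (conj x0 x1)).
  rewrite /=.
  apply: (@le_trans _ _ (expR (- n%:R))).
    apply: (@le_trans _ _ (expR (- x ^+ (2 * n)) ^+ (n * 4 ^ n))).
      apply: lerXn2r; rewrite ?nnegrE ?expR_ge0 ?subr_ge0 ?exprn_ile1//.
      exact: expR_ge1Dx.
    rewrite -expRM_natl ler_expR mulrN lerN2.
    have -> : (n * 4 ^ n)%:R * x ^+ (2 * n) = n%:R * (2 * x) ^+ (2 * n).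
      rewrite natrM natrX -!mulrA; congr (_ * _).
      by rewrite !(exprM _ 2) -exprMn; congr (_ ^+ n); ring.
    by rewrite ler_peMr// exprn_ege1//; lra.
  rewrite expRN /harmonic/= lef_pV2 ?posrE ?expR_gt0//.
  by apply: le_trans (expR_ge1Dx _); rewrite nat1r.
- exact: cvg_cst.
- exact: cvg_harmonic.
Qed.
End Sharpening.

(** * From powers to Gaussian functions and intervals *)

Section Completeness.
Import numFieldNormedType.Exports.
Context {d : measure_display} {T : measurableType d} {R : realType}.
Variable P : probability T R.
Implicit Types H Y : T -> R.
Local Notation mean := (mean P).
Local Notation all_moments := (all_moments P).

Lemma mean_dominated0 (f : nat -> T -> R) (f' g : T -> R) :
  (forall n, measurable_fun setT (f n)) ->
  (forall w, f n w @[n --> \oo] --> f' w) ->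
  P.-integrable setT (EFin \o g) ->
  (forall n w, `|f n w| <= g w) ->
  (forall n, mean (f n) = 0) -> mean f' = 0.
Proof.
move=> mf ff ig fg f0.
have cv : (\int[P]_w (f n w)%:E @[n --> \oo] --> \int[P]_w (f' w)%:E)%E.
  apply: (@dominated_cvg _ _ _ P setT measurableT (fun n => EFin \o f n)
     (EFin \o f') (EFin \o g)) => //.
  - by move=> n; exact/measurable_EFinP.
  - by move=> w _; apply: cvg_EFin; [exact: nearW|exact: ff].
  - by move=> n w _; rewrite /= lee_fin.
have e0 n : (\int[P]_w (f n w)%:E = 0)%E.
  have fi : P.-integrable setT (EFin \o f n).
    apply: le_integrable ig => //; first exact/measurable_EFinP.
    by move=> w _ /=; rewrite lee_fin (le_trans (fg n w))// ler_norm.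
  by rewrite -[LHS]fineK ?integrable_fin_num//; congr EFin; exact: f0.
have : (\int[P]_w (f' w)%:E = 0)%E.
  move: cv; rewrite (_ : (fun n => \int[P]_w (f n w)%:E)%E = fun=> 0%E).
    by move=> cv; apply/esym; exact: (cvg_unique _ (cvg_cst _) cv).
  by apply/funext.
by rewrite /mean /Rintegral => ->.
Qed.

Definition orthogonal_to_powers H Y := forall k, mean (fun w => H w * Y w ^+ k) = 0.

(** The partial sums of the series are bounded by [exp |g|], and a product is at most the sum of the
    squares of its factors. Squaring doubles the rate, so [c / 2] in the bound on [g] is what the
    integrability of [exp(c Y^2)] permits. *)
Lemma mean_expR0 H Y (g : T -> R) c c0 : all_moments H -> measurable_fun setT Y ->
  P.-integrable setT (fun w => (expR (c * Y w ^+ 2))%:E) ->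
  all_moments g -> (forall w, `|g w| <= c / 2 * Y w ^+ 2 + c0) ->
  (forall i, mean (fun w => H w * g w ^+ i) = 0) ->
  mean (fun w => H w * expR (g w)) = 0.
Proof.
move=> mH mY ie mg gc g0.
have maH := all_moments_measurable mH; have mag := all_moments_measurable mg.
pose dom w := H w ^+ 2 + expR (2 * c0) * expR (c * Y w ^+ 2).
apply: (@mean_dominated0 (fun n w => H w * series (exp_coeff (g w)) n) _ dom).
- move=> n; apply: measurable_funM => //; rewrite /series/=.
  apply: measurable_sum => i; apply: measurable_funM => //.
  exact: measurable_funX.
- by move=> w; apply: cvgM; [exact: cvg_cst|exact: is_cvg_series_exp_coeff].
- have i1 := all_moments_integrable (all_momentsX 2 mH).
  have i2 := integrableZl measurableT (expR (2 * c0)) ie.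
  by apply: eq_integrable (integrableD measurableT i1 i2).
- move=> n w; rewrite normrM.
  have h1 : `|series (exp_coeff (g w)) n| <= expR (c / 2 * Y w ^+ 2 + c0).
    by apply: le_trans (norm_expR_partial_sum_le _ _) _; rewrite ler_expR.
  have e2 : expR (c / 2 * Y w ^+ 2 + c0) ^+ 2 = expR (2 * c0) * expR (c * Y w ^+ 2).
    by rewrite -expRM_natl -expRD; congr expR; field.
  rewrite /dom -e2 -(real_normK (num_real (H w))).
  have := sqr_ge0 (`|H w| - expR (c / 2 * Y w ^+ 2 + c0)).
  have := normr_ge0 (H w); have := normr_ge0 (series (exp_coeff (g w)) n).
  by move: h1; set e := expR _; set q := `|series _ _|; set h := `|H w|; nra.
- move=> n; rewrite /series/=.
  transitivity (mean (fun w => \sum_(0 <= i < n) i`!%:R^-1 * (H w * g w ^+ i))).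
    apply: mean_ext => w; rewrite mulr_sumr; apply: eq_bigr => i _.
    by rewrite /exp_coeff/=; ring.
  have mHg i : all_moments (fun w => H w * g w ^+ i).
    by apply: all_momentsM => //; exact: all_momentsX.
  rewrite mean_sum => [|i]; last exact: all_momentsZ.
  by rewrite big1// => i _; rewrite meanZ// g0 mulr0.
Qed.

Lemma orthogonal_gauss_factor H Y c s : all_moments H -> all_moments Y ->
  P.-integrable setT (fun w => (expR (c * Y w ^+ 2))%:E) ->
  0 <= s <= c / 2 -> orthogonal_to_powers H Y ->
  orthogonal_to_powers (fun w => H w * expR (- s * Y w ^+ 2)) Y.
Proof.
move=> mH mY ie /andP[s0 sc] HY k.
transitivity (mean (fun w => H w * Y w ^+ k * expR (- s * Y w ^+ 2))).
  by apply: mean_ext => w; rewrite mulrAC.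
have mHY : all_moments (fun w => H w * Y w ^+ k).
  by apply: all_momentsM => //; exact: all_momentsX.
apply: (mean_expR0 (c0 := 0) mHY (all_moments_measurable mY) ie).
- by apply: all_momentsZ; exact: all_momentsX.
- move=> w; have Y2 := sqr_ge0 (Y w).
  rewrite addr0 mulNr normrN ger0_norm; last exact: mulr_ge0.
  exact: ler_wpM2r.
- move=> i; transitivity (mean (fun w => (- s) ^+ i * (H w * Y w ^+ (k + i * 2)))).
    by apply: mean_ext => w; rewrite exprMn exprD (mulnC i) exprM; ring.
  rewrite meanZ ?HY ?mulr0//.
  by apply: all_momentsM => //; exact: all_momentsX.
Qed.

Lemma all_moments_gauss_factor H Y s : all_moments H -> measurable_fun setT Y -> 0 <= s ->
  all_moments (fun w => H w * expR (- s * Y w ^+ 2)).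
Proof.
move=> mH mY s0; apply: all_momentsM => //.
apply: (@all_moments_bounded _ _ _ _ _ 1).
  apply: measurableT_comp => //; apply: measurable_funM => //.
  exact: measurable_funX.
move=> w; rewrite ger0_norm ?expR_ge0// -[leRHS]expR0 ler_expR mulNr oppr_le0.
by rewrite mulr_ge0// sqr_ge0.
Qed.

(** The rate [s] is divided into [j + 1] equal steps [t <= c / 2], and the factor [exp(-t Y^2)] is
    inserted that many times. The shift by [y] then costs one exponential of a linear function of
    [Y], admissible whatever its coefficient. *)
Lemma mean_shifted_gauss0 H Y s y : all_moments H -> exp_square_integrable P Y ->
  orthogonal_to_powers H Y -> 0 <= s ->
  mean (fun w => H w * expR (- s * (Y w - y) ^+ 2)) = 0.
Proof.
move=> mH eY HY s0; have mY := exp_square_all_moments eY.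
have [meY [c cp ie]] := eY.
have [j js] : exists j, s <= j%:R * (c / 2).
  exists (Num.bound (s / (c / 2))); rewrite -ler_pdivrMr ?divr_gt0//.
  by apply: ltW; apply: archi_boundP; rewrite divr_ge0// divr_ge0// ltW.
pose t := s / j.+1%:R.
have t0 : 0 <= t <= c / 2.
  rewrite /t divr_ge0//= ler_pdivrMr ?ltr0n// (le_trans js)// mulrC ler_wpM2l ?ler_nat//.
  by rewrite divr_ge0// ltW.
have /andP[t00 _] := t0.
have step i : all_moments (fun w => H w * expR (- (i%:R * t) * Y w ^+ 2)) /\
    orthogonal_to_powers (fun w => H w * expR (- (i%:R * t) * Y w ^+ 2)) Y.
  elim: i => [|i [ih1 ih2]].
    have -> : (fun w => H w * expR (- (0%:R * t) * Y w ^+ 2)) = H.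
      by apply/funext => w; rewrite mul0r oppr0 mul0r expR0 mulr1.
    by [].
  have -> : (fun w => H w * expR (- (i.+1%:R * t) * Y w ^+ 2)) =
     (fun w => H w * expR (- (i%:R * t) * Y w ^+ 2) * expR (- t * Y w ^+ 2)).
    apply/funext => w; rewrite -mulrA -expRD; congr (_ * expR _).
    by rewrite -natr1; ring.
  split; first exact: all_moments_gauss_factor.
  exact: (orthogonal_gauss_factor ih1 mY ie t0 ih2).
have [mHs Hs] := step j.+1.
have st : j.+1%:R * t = s by rewrite /t mulrC divfK// pnatr_eq0.
rewrite st in mHs Hs.
pose C := expR (- s * y ^+ 2).
have mCHs := all_momentsZ C mHs.
have -> : (fun w => H w * expR (- s * (Y w - y) ^+ 2)) =
  (fun w => C * (H w * expR (- s * Y w ^+ 2)) * expR (2 * s * y * Y w)).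
  apply/funext => w; rewrite /C (_ : - s * (Y w - y) ^+ 2 =
    - s * y ^+ 2 + (- s * Y w ^+ 2 + 2 * s * y * Y w)); last by ring.
  by rewrite !expRD; ring.
(* The constant is the one in Young's inequality for the product of [2 s y] and [Y], with weight
   [c / 2] on [Y^2]. *)
apply: (mean_expR0 (c0 := (2 * s * y) ^+ 2 / (2 * c)) mCHs meY ie).
- exact: all_momentsZ.
- move=> w; rewrite normrM.
  have c20 : 0 < 2 * c by rewrite mulr_gt0.
  rewrite -(ler_pM2l c20) mulrDr.
  have -> : 2 * c * (c / 2 * Y w ^+ 2) = (c * `|Y w|) ^+ 2.
    by rewrite exprMn real_normK ?num_real//; field.
  have -> : 2 * c * ((2 * s * y) ^+ 2 / (2 * c)) = `|2 * s * y| ^+ 2.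
    by rewrite real_normK ?num_real// mulrC divfK// gt_eqF.
  have := sqr_ge0 (c * `|Y w| - `|2 * s * y|); nra.
- move=> i; transitivity (mean (fun w => C * (2 * s * y) ^+ i * (H w * expR (- s * Y w ^+ 2) * Y w ^+ i))).
    by apply: mean_ext => w; rewrite exprMn; ring.
  by rewrite meanZ ?Hs ?mulr0//; apply: all_momentsM => //; exact: all_momentsX.
Qed.

(** Each power of [u] is a Gaussian function with the same centre, so [H] is orthogonal to all
    polynomials in [u]. The sharpening polynomials give the complement of the ball in the limit, and
    [H] has mean zero. *)
Lemma mean_closed_ball0 H Y y r : all_moments H -> exp_square_integrable P Y ->
  orthogonal_to_powers H Y -> 0 < r ->
  mean (fun w => H w * \1_(`[y - r, y + r]) (Y w)) = 0.
Proof.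
move=> mH eY HY r0; have [meY _] := eY.
have maH := all_moments_measurable mH.
(* With this rate [u] equals 1/2 exactly at distance [r] from [y]. *)
pose s := ln 2 / r ^+ 2.
have ln2 : 0 < ln 2 :> R by rewrite ln_gt0// ltr1n.
have s0 : 0 <= s by rewrite divr_ge0// ?sqr_ge0// ltW.
pose u w := expR (- s * (Y w - y) ^+ 2).
have u01 w : 0 <= u w <= 1.
  rewrite expR_ge0/= -[leRHS]expR0 ler_expR mulNr oppr_le0.
  by rewrite mulr_ge0// sqr_ge0.
have mu : measurable_fun setT u.
  apply: measurableT_comp => //; apply: measurable_funM => //.
  by apply: measurable_funX; exact: measurable_funB.
have mHu i : all_moments (fun w => H w * u w ^+ i).
  apply: all_momentsM => //; apply: (@all_moments_bounded _ _ _ _ _ 1).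
    exact: measurable_funX.
  by move=> w; have /andP[? ?] := u01 w; rewrite normrX ger0_norm// exprn_ile1.
have Hu0 i : mean (fun w => H w * u w ^+ i) = 0.
  transitivity (mean (fun w => H w * expR (- (i%:R * s) * (Y w - y) ^+ 2))).
    by apply: mean_ext => w; rewrite /u -expRM_natl; congr (_ * expR _); ring.
  by apply: mean_shifted_gauss0 => //; rewrite mulr_ge0.
have uball w : (Y w \in `[y - r, y + r]) = (2^-1 <= u w).
  rewrite /u -[X in X^-1](lnK (_ : 2 \is Num.pos)) ?posrE// -expRN ler_expR.
  rewrite /s mulNr lerN2 in_itv/= -ler_distl mulrAC ler_pdivrMr ?exprn_gt0//.
  rewrite ler_pM2l// -(real_normK (num_real (Y w - y))).
  by rewrite ler_pXn2r// nnegrE// ltW.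
have H0 : mean H = 0.
  by rewrite -[RHS](Hu0 0%N); apply: mean_ext => w; rewrite mulr1.
have main : mean (fun w => H w * (1 - \1_(`[y - r, y + r]) (Y w))) = 0.
  apply: (@mean_dominated0 (fun n w => H w * sharpening n (u w)) _ (fun w => `|H w|)).
  - move=> n; apply: measurable_funM => //; apply: measurable_funX.
    by apply: measurable_funB => //; exact: measurable_funX.
  - move=> w; apply: cvgM; first exact: cvg_cst.
    have /andP[u0 u1] := u01 w; rewrite indicE.
    have -> : (Y w \in `[y - r, y + r]%classic) = (Y w \in `[y - r, y + r]).
      by apply/idP/idP => [/set_mem//|h]; exact: mem_set.
    rewrite uball; have [h|h] := leP.
      by rewrite subrr; exact: sharpening_cvg0.
    by rewrite subr0; exact: sharpening_cvg1.
  - exact: (integrable_abse (all_moments_integrable mH)).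
  - move=> n w; rewrite normrM ler_piMr//.
    by have /andP[h1 h2] := sharpening_ge0_le1 n (u01 w); rewrite ger0_norm.
  - move=> n; rewrite /sharpening.
    transitivity (mean (fun w => \sum_(i < (n * 4 ^ n).+1)
      ((-1) ^+ i *+ 'C(n * 4 ^ n, i)) * (H w * u w ^+ (2 * n * i)))).
      apply: mean_ext => w; rewrite exprBn mulr_sumr; apply: eq_bigr => i _.
      by rewrite expr1n mulr1 (exprM _ (2 * n)) mulrnAr mulrnAl; congr (_ *+ _); ring.
    rewrite mean_sum => [|i]; last exact: all_momentsZ.
    by rewrite big1// => i _; rewrite meanZ// Hu0 mulr0.
have mI : all_moments (fun w => H w * \1_(`[y - r, y + r]) (Y w)).
  apply: all_momentsM => //; apply: (@all_moments_bounded _ _ _ _ _ 1).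
    by apply: measurableT_comp => //; apply: measurable_indic; exact: measurable_itv.
  by move=> w; rewrite indicE; case: (_ \in _); rewrite ?normr1 ?normr0.
have : mean H = mean (fun w => H w * (1 - \1_(`[y - r, y + r]) (Y w)) +
    H w * \1_(`[y - r, y + r]) (Y w)).
  by apply: mean_ext => w; rewrite -mulrDr subrK mulr1.
rewrite meanD//; last first.
  have -> : (fun w => H w * (1 - \1_(`[y - r, y + r]) (Y w))) =
     (fun w => H w + -1 * (H w * \1_(`[y - r, y + r]) (Y w))).
    by apply/funext => w; ring.
  by apply: all_momentsD => //; exact: all_momentsZ.
by rewrite main H0 add0r.
Qed.

End Completeness.

(** * Independence and correlation *)

Section Borel.
Import numFieldNormedType.Exports.
Context {d : measure_display} {T : measurableType d} {R : realType}.
Variable P : probability T R.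
Implicit Types H Y : T -> R.
Local Notation mean := (mean P).
Local Notation all_moments := (all_moments P).

Lemma in_preimage Y (A : set R) w : (w \in Y @^-1` A) = (Y w \in A).
Proof. by apply/idP/idP => /set_mem h; exact: mem_set. Qed.

Lemma all_moments_indic Y (A : set R) : measurable_fun setT Y -> measurable A ->
  all_moments (fun w => \1_A (Y w)).
Proof.
move=> mY mA; apply: (@all_moments_bounded _ _ _ _ _ 1).
  by apply: measurableT_comp => //; exact: measurable_indic.
by move=> w; rewrite indicE; case: (_ \in _); rewrite ?normr1 ?normr0.
Qed.

(** Dynkin's argument. Closed rays are stable under intersection and generate the Borel sets, and
    each is an increasing limit of closed balls. *)
Lemma mean_borel0 H Y (A : set R) : all_moments H -> exp_square_integrable P Y ->
  orthogonal_to_powers P H Y -> measurable A ->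
  mean (fun w => H w * \1_A (Y w)) = 0.
Proof.
move=> mH eY HY mA; have [meY _] := eY.
have maH := all_moments_measurable mH.
have mHI B : measurable B -> all_moments (fun w => H w * \1_B (Y w)).
  by move=> mB; apply: all_momentsM => //; exact: all_moments_indic.
have H0 : mean H = 0.
  by rewrite -[RHS](HY 0%N); apply: mean_ext => w; rewrite mulr1.
pose Z (B : set (measurableTypeR R)) := mean (fun w => H w * \1_B (Y w)) = 0.
suff : forall S, <<s @RGenCInfty.G R >> S -> Z S.
  by apply; rewrite -[X in X A]RGenCInfty.measurableE.
apply: (@dynkin_induction _ (measurableTypeR R)).
- exact: RGenCInfty.measurableE.
- move=> _ _ [x ->] [y ->]; exists (Num.max x y); apply/seteqP; split => z /=;
    rewrite !in_itv/= !andbT ge_max; first by move=> [-> ->].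
  by move=> /andP[].
- by rewrite /Z -[RHS]H0; apply: mean_ext => w; rewrite indicT mulr1.
- move=> _ [x ->]; rewrite /Z.
  (* This is the interval from [x] to [x + 2(n+1)], written by centre and radius. *)
  pose A' n : set R := `[x + n.+1%:R - n.+1%:R, x + n.+1%:R + n.+1%:R]%classic.
  apply: (@mean_dominated0 _ _ _ P (fun n w => H w * \1_(A' n) (Y w)) _ (fun w => `|H w|)).
  + by move=> n; apply: (all_moments_measurable (mHI _ _)); exact: measurable_itv.
  + move=> w; apply: cvg_near_cst; near=> n; rewrite !indicE; congr (_ * (nat_of_bool _)%:R).
    apply/idP/idP => /set_mem/=; rewrite /A'/= !in_itv/= ?addrK ?andbT => h; apply/mem_set => /=;
      rewrite !in_itv/= ?addrK ?andbT; first by case/andP: h.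
    rewrite h/= -addrA -lerBlDl -natrD.
    apply: (@le_trans _ _ n%:R).
      by near: n; exact: nbhs_infty_ger.
    by rewrite ler_nat addnS ltnW// ltnS leqW// leq_addr.
  + exact: (integrable_abse (all_moments_integrable mH)).
  + move=> n w; rewrite normrM ler_piMr// indicE.
    by case: (_ \in _); rewrite ?normr1 ?normr0.
  + by move=> n; apply: mean_closed_ball0 => //; rewrite ltr0n.
- move=> S mS ZS; rewrite /Z.
  transitivity (mean (fun w => H w + -1 * (H w * \1_S (Y w)))).
    by apply: mean_ext => w; rewrite !indicE in_setC; case: (_ \in S) => /=; ring.
  rewrite meanD//; last by apply: all_momentsZ; exact: mHI.
  by rewrite meanZ ?ZS ?H0 ?mulr0 ?addr0//; exact: mHI.
(* [H] changes sign, so additivity over the disjoint union is that of the integral of an integrable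
   function. *)
- move=> F mF tF ZF; rewrite /Z.
  have mU : measurable (\bigcup_k F k) by exact: bigcupT_measurable.
  have red B : measurable B -> (\int[P]_(w in Y @^-1` B) (H w)%:E =
      (mean (fun w => H w * \1_B (Y w)))%:E)%E.
    move=> mB; rewrite EFin_mean; last exact: mHI.
    rewrite integral_mkcond; apply: eq_integral => w _.
    by rewrite patchE indicE in_preimage; case: ifPn => _; rewrite ?mulr1 ?mulr0.
  have mYF B : measurable B -> measurable (Y @^-1` B).
    by move=> mB; rewrite -[X in measurable X]setTI; exact: meY.
  apply: EFin_inj; rewrite -red// preimage_bigcup integral_bigcup//.
  + by rewrite eseries0// => i _ _; rewrite red ?ZF//; exact: mF.
  + apply/trivIsetP => i j _ _ ij.
    by move/trivIsetP : tF => /(_ i j I I ij) Fij; rewrite -preimage_setI Fij preimage_set0.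
  + by move=> k; apply: mYF; exact: mF.
  + apply: integrableS (all_moments_integrable mH) => //.
    by apply: bigcupT_measurable => k; apply: mYF; exact: mF.
Unshelve. all: by end_near. Qed.

(** Completeness applied to [D - E[D]]: the factorization hypothesis says that it is orthogonal to
    all powers of [Y]. *)
Lemma mean_indic_factor D Y (A : set R) : all_moments D -> exp_square_integrable P Y ->
  measurable A ->
  (forall k, mean (fun w => D w * Y w ^+ k) = mean D * mean (fun w => Y w ^+ k)) ->
  mean (fun w => D w * \1_A (Y w)) = mean D * fine (P (Y @^-1` A)).
Proof.
move=> mD eY mA fac; have [meY _] := eY.
have mY := exp_square_all_moments eY.
have mI := all_moments_indic meY mA.
have -> : fine (P (Y @^-1` A)) = mean (fun w => \1_A (Y w)).
  rewrite /mean /Rintegral; congr fine.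
  rewrite (eq_integral (fun w => (\1_(Y @^-1` A) w)%:E)).
    by rewrite integral_indic// ?setIT// -[X in measurable X]setTI; exact: meY.
  by move=> w _; rewrite !indicE in_preimage.
have mK : all_moments (fun w => D w + - mean D * 1).
  by apply: all_momentsD => //; apply: all_momentsZ; exact: all_moments_cst.
have := @mean_borel0 (fun w => D w + - mean D * 1) Y A mK eY _ mA.
have red f : all_moments f -> mean (fun w => (D w + - mean D * 1) * f w) =
    mean (fun w => D w * f w) - mean D * mean f.
  move=> mf; rewrite -mulNr -meanZ// -meanD; last 2 first.
  - exact: all_momentsM.
  - exact: all_momentsZ.
  by apply: mean_ext => w; ring.
rewrite red// => /(_ _)/eqP; rewrite subr_eq0 => h; apply/eqP/h => k.
by rewrite red ?fac ?subrr//; exact: all_momentsX.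
Qed.

(* Powers are replaced by indicators one variable at a time. *)
Lemma mean_prod_indic (I : eqType) (r : seq I) (Y : I -> T -> R) (B : I -> set R) (D : T -> R) :
  uniq r -> all_moments D -> (forall i, exp_square_integrable P (Y i)) ->
  (forall i, measurable (B i)) ->
  (forall k : I -> nat, mean (fun w => D w * \prod_(i <- r) Y i w ^+ k i) =
     mean D * \prod_(i <- r) mean (fun w => Y i w ^+ k i)) ->
  mean (fun w => D w * \prod_(i <- r) \1_(B i) (Y i w)) =
  mean D * \prod_(i <- r) fine (P (Y i @^-1` B i)).
Proof.
move=> + + eY mB; elim: r D => [|i r ih] D /=.
  by move=> _ mD _; rewrite big_nil mulr1; apply: mean_ext => w; rewrite big_nil mulr1.
move=> /andP[ir ur] mD fac.
have mY j : all_moments (Y j) by exact: exp_square_all_moments.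
have mI : all_moments (fun w => \1_(B i) (Y i w)).
  by apply: all_moments_indic => //; have [] := eY i.
(* Changing the exponent of the head variable alone lets it run freely while the others stay fixed;
   exponent 0 removes that variable. *)
pose upd k k0 j := if j == i then k0 else k j : nat.
have updi k k0 : upd k k0 i = k0 by rewrite /upd eqxx.
have prodE (k : I -> nat) k0 (F : I -> nat -> R) :
    \prod_(j <- r) F j (upd k k0 j) = \prod_(j <- r) F j (k j).
  apply: eq_big_seq => j jr; rewrite /upd.
  by case: eqP => // ji; move: ir; rewrite -ji jr.
have mean1 : mean (fun w => 1) = 1 by exact: mean_cst.
have fac0 k : mean (fun w => D w * \prod_(j <- r) Y j w ^+ k j) =
    mean D * \prod_(j <- r) mean (fun w => Y j w ^+ k j).
  have := fac (upd k 0%N).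
  rewrite big_cons (prodE k 0%N (fun j e => mean (fun w => Y j w ^+ e))) updi.
  rewrite (_ : mean (fun w => Y i w ^+ 0) = 1) ?mul1r//.
  move=> <-; apply: mean_ext => w; rewrite big_cons.
  by rewrite (prodE k 0%N (fun j e => Y j w ^+ e)) updi mul1r.
(* The factorization hypothesis for the tail, with [D] multiplied by the indicator of the head
   variable. *)
have step k : mean (fun w => D w * \1_(B i) (Y i w) * \prod_(j <- r) Y j w ^+ k j) =
    mean D * fine (P (Y i @^-1` B i)) * \prod_(j <- r) mean (fun w => Y j w ^+ k j).
  have mDk : all_moments (fun w => D w * \prod_(j <- r) Y j w ^+ k j).
    by apply: all_momentsM => //; apply: all_moments_prod => j; exact: all_momentsX.
  rewrite [RHS]mulrAC -fac0 -(mean_indic_factor mDk (eY i) (mB i)).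
    by apply: mean_ext => w; rewrite mulrAC.
  move=> k0; rewrite fac0.
  have := fac (upd k k0).
  rewrite big_cons (prodE k k0 (fun j e => mean (fun w => Y j w ^+ e))) updi.
  rewrite [mean D * (_ * _)]mulrCA mulrC => <-.
  apply: mean_ext => w; rewrite big_cons.
  by rewrite (prodE k k0 (fun j e => Y j w ^+ e)) updi mulrAC mulrA.
have Dfac : mean (fun w => D w * \1_(B i) (Y i w)) = mean D * fine (P (Y i @^-1` B i)).
  have := step (fun=> 0%N); rewrite big1_seq ?mulr1; last by move=> j _; exact: mean1.
  by move=> <-; apply: mean_ext => w; rewrite big1_seq ?mulr1// => j _; rewrite expr0.
rewrite big_cons mulrA -Dfac -ih//; last by move=> k; rewrite step Dfac.
  by apply: mean_ext => w; rewrite big_cons mulrA.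
exact: all_momentsM.
Qed.

End Borel.

Lemma eq_lt_trans {d : Order.disp_t} {E : porderType d} (x y z : E) : x = y -> (y < z)%O -> (x < z)%O.
Proof. by move=> ->. Qed.

(** * Products of independent variables *)

Section IndependentMean.
Import numFieldNormedType.Exports.
Context {d : measure_display} {T : measurableType d} {R : realType}.
Variable P : probability T R.

(** The law of the pair agrees with the product of the two laws on rectangles, hence everywhere, and
    Fubini's theorem separates the variables. *)
Lemma independent_mean (U V : T -> R) : all_moments P U -> all_moments P V ->
  (forall A B : set R, measurable A -> measurable B ->
    (P (U @^-1` A `&` V @^-1` B) = P (U @^-1` A) * P (V @^-1` B))%E) ->
  mean P (fun w => U w * V w) = mean P U * mean P V.
Proof.
move=> mU mV ind.
have meU := all_moments_measurable mU; have meV := all_moments_measurable mV.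
pose U' : {mfun T >-> R} := HB.pack U (isMeasurableFun.Build _ _ _ _ U meU).
pose V' : {mfun T >-> R} := HB.pack V (isMeasurableFun.Build _ _ _ _ V meV).
have meW : measurable_fun setT (fun w => (U w, V w)) by exact: measurable_fun_pair.
pose W' : {mfun T >-> (R * R)%type} := HB.pack (fun w => (U w, V w))
  (isMeasurableFun.Build _ _ _ _ (fun w => (U w, V w)) meW).
pose m1 := distribution P U'. pose m2 := distribution P V'.
have law A : measurable A -> (m1 \x m2)%E A = distribution P W' A.
  apply: product_measure_unique => A' B' mA mB.
  by rewrite /m1 /m2 /distribution /pushforward/= -ind.
have mf : measurable_fun setT (fun p : R * R => (p.1 * p.2)%:E).
  by apply/measurable_EFinP; apply: measurable_funM.
have mUV := all_moments_integrable (all_momentsM mU mV).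
have eW : (\int[m1 \x m2]_p (p.1 * p.2)%:E = \int[P]_w (U w * V w)%:E)%E.
  have := @integral_distribution _ _ _ _ _ P W' _ mf mUV.
  rewrite -[X in _ = X -> _]/(\int[P]_w (U w * V w)%:E)%E => <-.
  by apply: eq_measure_integral => A mA _; exact: law.
have iW : (m1 \x m2)%E.-integrable setT (fun p : R * R => (p.1 * p.2)%:E).
  apply/integrableP; split => //.
  have mabs := measurableT_comp (@abse_measurable R setT) mf.
  have e := @ge0_integral_distribution _ _ _ _ _ P W' _ mabs (fun=> abse_ge0 _).
  have : (\int[distribution P W']_p `|(p.1 * p.2)%:E| < +oo)%E.
    by case/integrableP: mUV => _ iUV; apply: eq_lt_trans e iUV.
  apply: le_lt_trans; rewrite le_eqVlt; apply/orP; left; apply/eqP.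
  by apply: eq_measure_integral => A mA _; exact: law.
apply: EFin_inj; rewrite EFinM EFin_mean; last exact: all_momentsM.
rewrite -eW -integral12_prod_meas1//= /fubini_F/=.
have dist (Z : {mfun T >-> R}) : all_moments P Z ->
    (distribution P Z).-integrable setT (fun x => x%:E) /\
    (\int[distribution P Z]_x x%:E = (mean P Z)%:E)%E.
  move=> mZ; have iZ := all_moments_integrable mZ.
  split; last by rewrite EFin_mean// integral_distribution//.
  apply/integrableP; split; first exact/measurable_EFinP.
  have mabs' : measurable_fun [set: R] (fun x => `|x%:E|%E) by exact: measurableT_comp.
  have e := @ge0_integral_distribution _ _ _ _ _ P Z _ mabs' (fun=> abse_ge0 _).
  case/integrableP: iZ => _ i; exact: (eq_lt_trans e).
have [i1 e1] := dist U' mU; have [i2 e2] := dist V' mV.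
under eq_integral => x _.
  under eq_integral do rewrite EFinM.
  rewrite integralZl// e2.
  over.
by rewrite integralZr// e1.
Qed.
End IndependentMean.

(** * Uncorrelated Gaussian coordinates *)

Section Uncorrelated.
Import numFieldNormedType.Exports.
Context {d : measure_display} {T : measurableType d} {R : realType}.
Variable P : probability T R.
Variables (n : nat) (X : 'I_n -> T -> R).
Hypothesis mX : forall i, measurable_fun setT (X i).
Hypothesis gX : centered_gaussian_vector P X.
Local Notation mean := (mean P).
Local Notation lin := (lin X).
Local Notation linprod := (linprod X).
Local Notation cov := (cov P X).

Definition unit_vec (i j : 'I_n) : R := (j == i)%:R.

Lemma lin_unit_vec i w : lin (unit_vec i) w = X i w.
Proof.
rewrite /lin (bigD1 i)//= /unit_vec eqxx mul1r big1 ?addr0// => j ji.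
by rewrite (negbTE ji) mul0r.
Qed.

Lemma linprod_unit_vec_nseq r (k : 'I_n -> nat) w :
  linprod (map unit_vec (flatten [seq nseq (k j) j | j <- r])) w =
  \prod_(j <- r) X j w ^+ k j.
Proof.
elim: r => [|j r ih]; first by rewrite /linprod !big_nil.
rewrite big_cons -ih /= map_cat /linprod big_cat/=; congr (_ * _).
elim: (k j) => [|e IH]; first by rewrite big_nil expr0.
by rewrite big_cons IH lin_unit_vec exprS.
Qed.

Lemma contract_orthogonal (F : seq ('I_n -> R) -> R) b js :
  (forall j, j \in js -> cov b (unit_vec j) = 0) ->
  contract P X F b (map unit_vec js) = 0.
Proof.
elim: js F => [//|j js ih] F bj /=.
rewrite bj ?mem_head// mul0r add0r ih// => i ijs; apply: bj.
by rewrite in_cons ijs orbT.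
Qed.

(** Wick's formula is applied to one factor of the power. All contractions with [js] vanish, so the
    left side obeys the same recursion in [k] as the moments of [lin a]. *)
Lemma mean_orthogonal_factor a k js :
  (forall j, j \in js -> cov a (unit_vec j) = 0) ->
  mean (fun w => lin a w ^+ k * linprod (map unit_vec js) w) =
  mean (fun w => lin a w ^+ k) * mean (linprod (map unit_vec js)).
Proof.
move=> aj; elim/ltn_ind: k => -[|k] ih.
  rewrite (_ : mean (fun w => _ ^+ 0) = 1).
    by rewrite mul1r; apply: mean_ext => w; rewrite mul1r.
  by rewrite -[RHS](mean_cst P); apply: mean_ext.
rewrite (mean_lin_recursion mX gX) -mulrA -ih; last by rewrite ltnS leq_pred.
under [LHS]mean_ext do rewrite exprS.
by rewrite (wick mX gX) contract_orthogonal// addr0.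
Qed.

Hypothesis uncorrelated : forall i j, i != j -> mean (fun w => X i w * X j w) = 0.

Lemma cov_unit_vec i j : cov (unit_vec i) (unit_vec j) = mean (fun w => X i w * X j w).
Proof. by apply: mean_ext => w; rewrite !lin_unit_vec. Qed.

Lemma uncorrelated_mean_prod r (k : 'I_n -> nat) : uniq r ->
  mean (fun w => \prod_(i <- r) X i w ^+ k i) = \prod_(i <- r) mean (fun w => X i w ^+ k i).
Proof.
elim: r => [_|i r ih /= /andP[ir ur]].
  by rewrite big_nil -[RHS](mean_cst P); apply: mean_ext => w; rewrite big_nil.
rewrite big_cons -ih//.
(* Each index [j] is listed [k j] times, so that the monomial becomes a [linprod]. *)
pose js := flatten [seq nseq (k j) j | j <- r].
have orth j : j \in js -> cov (unit_vec i) (unit_vec j) = 0.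
  move=> /flattenP[s /mapP[l lr ->]]; rewrite mem_nseq => /andP[_ /eqP ->].
  by rewrite cov_unit_vec uncorrelated//; apply: contraNneq ir => ->.
have := mean_orthogonal_factor (k i) orth.
rewrite (_ : mean (linprod _) = mean (fun w => \prod_(j <- r) X j w ^+ k j)).
  move=> e; rewrite (_ : mean (fun w => X i w ^+ k i) = mean (fun w => lin (unit_vec i) w ^+ k i)).
    rewrite -e; apply: mean_ext => w.
    by rewrite big_cons lin_unit_vec linprod_unit_vec_nseq.
  by apply: mean_ext => w; rewrite lin_unit_vec.
by apply: mean_ext => w; rewrite linprod_unit_vec_nseq.
Qed.

Lemma uncorrelated_independent : mutually_independent P X.
Proof.
move=> B mB.
have eX i : exp_square_integrable P (X i).
  have := exp_square_lin mX gX (unit_vec i).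
  by rewrite (_ : lin (unit_vec i) = X i)//; apply/funext => w; rewrite lin_unit_vec.
have mXB i : measurable (X i @^-1` B i).
  by rewrite -[X in measurable X]setTI; exact: mX.
have mI : measurable (\bigcap_(i in [set: 'I_n]) (X i @^-1` B i)).
  by apply: fin_bigcap_measurable => //; exact: finite_finset.
have := @mean_prod_indic _ _ _ P _ (index_enum 'I_n) X B (fun=> 1) (index_enum_uniq _)
  (all_moments_cst P 1) eX mB.
rewrite mean_cst mul1r => h.
have {}h : mean (fun w => 1 * \prod_(i < n) \1_(B i) (X i w)) =
    \prod_(i < n) fine (P (X i @^-1` B i)).
  apply: h => k; rewrite mul1r -uncorrelated_mean_prod ?index_enum_uniq//.
  by apply: mean_ext => w; rewrite mul1r.
have -> : (\prod_(i < n) P (X i @^-1` B i) =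
    (\prod_(i < n) fine (P (X i @^-1` B i)))%:E)%E.
  elim/big_ind2 : _ => //; first by move=> x _ y _ -> ->; rewrite EFinM.
  by move=> i _; rewrite fineK// fin_num_measure.
rewrite -h.
rewrite (_ : mean _ = fine (P (\bigcap_(i in [set: 'I_n]) (X i @^-1` B i)))).
  by rewrite fineK// fin_num_measure.
rewrite /mean /Rintegral; congr fine.
rewrite (eq_integral (fun w => (\1_(\bigcap_(i in [set: 'I_n]) (X i @^-1` B i)) w)%:E)).
  by rewrite integral_indic// setIT.
move=> w _; congr EFin; rewrite mul1r indicE.
have [|] := boolP (w \in _).
  move=> /set_mem h'; rewrite big1// => i _; rewrite indicE mem_set//; exact: h'.
move=> /negP h'; apply/eqP/negPn/negP => /prodf_neq0 h''; apply: h'.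
apply/mem_set => i _ /=; have := h'' i isT; rewrite indicE.
by case: (boolP (X i w \in B i)) => [/set_mem//|]; rewrite eqxx.
Qed.

End Uncorrelated.

(** * The product inequality *)

Section Final.
Context {d : measure_display} {T : measurableType d} {R : realType}.
Variable P : probability T R.

Lemma mutually_independent_pair n (X : 'I_n -> T -> R) i j (A B : set R) :
  mutually_independent P X -> i != j -> measurable A -> measurable B ->
  (P (X i @^-1` A `&` X j @^-1` B) = P (X i @^-1` A) * P (X j @^-1` B))%E.
Proof.
move=> ind ij mA mB.
pose C k : set R := if k == i then A else if k == j then B else setT.
have Ci : C i = A by rewrite /C eqxx.
have Cj : C j = B by rewrite /C eq_sym (negbTE ij) eqxx.
have mC k : measurable (C k) by rewrite /C; case: eqP => // _; case: eqP.
have := ind C mC; rewrite (bigD1 i)//= (bigD1 j) ?(eq_sym j)//= Ci Cj big1 ?mule1.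
  move=> <-; congr (P _); apply/seteqP; split => w /=.
    move=> [wA wB] k _ /=; rewrite /C; case: eqP => [->//|_].
    by case: eqP => [->//|].
  by move=> h; split; [have := h i I; rewrite Ci|have := h j I; rewrite Cj].
move=> k /andP[ki kj]; rewrite /C (negbTE ki) (negbTE kj) preimage_setT.
exact: probability_setT.
Qed.

Lemma expectation_mean (f : T -> R) : all_moments P f -> ('E_P[f] = (mean P f)%:E)%E.
Proof. by move=> mf; rewrite unlock EFin_mean. Qed.

Section Vector.
Variables (n : nat) (X : 'I_n -> T -> R).
Hypothesis mX : forall i, measurable_fun setT (X i).
Hypothesis gX : centered_gaussian_vector P X.
Local Notation mean := (mean P).
Local Notation lin := (lin X).
Local Notation cov := (cov P X).

Lemma all_moments_coord i : all_moments P (X i).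
Proof.
have := all_moments_lin mX gX (unit_vec i).
by rewrite (_ : lin (unit_vec i) = X i)//; apply/funext => w; rewrite lin_unit_vec.
Qed.

Lemma mean_coord i : mean (X i) = 0.
Proof.
rewrite -(mean_linX_odd mX gX (unit_vec i) (isT : odd 1)).
by apply: mean_ext => w; rewrite lin_unit_vec expr1.
Qed.

Lemma independent_uncorrelated i j : mutually_independent P X -> i != j ->
  mean (fun w => X i w * X j w) = 0.
Proof.
move=> ind ij; rewrite (independent_mean (all_moments_coord i) (all_moments_coord j)).
  by rewrite !mean_coord mul0r.
by move=> A B mA mB; exact: mutually_independent_pair.
Qed.

Lemma variance_coord i : ('V_P[X i] = (mean (fun w => X i w ^+ 2))%:E)%E.
Proof.
have mXi := all_moments_coord i.
rewrite /variance covariance.unlock (expectation_mean mXi) mean_coord/=.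
rewrite -expectation_mean; last exact: all_momentsX.
rewrite unlock; apply: eq_integral => w _; congr EFin.
by rewrite /= !fctE/= subr0 expr2.
Qed.

Lemma covZl a x y : cov (fun i => x * a i) y = x * cov a y.
Proof.
rewrite /cov -meanZ; last exact: all_momentsM (all_moments_lin mX gX _) (all_moments_lin mX gX _).
apply: mean_ext => w; rewrite mulrA; congr (_ * _).
by rewrite /lin mulr_sumr; apply: eq_bigr => i _; rewrite mulrA.
Qed.

Lemma covZr a x y : cov y (fun i => x * a i) = x * cov y a.
Proof. by rewrite covC covZl covC. Qed.

Lemma cov_ge0 a : 0 <= cov a a.
Proof. by apply: mean_ge0 => w; rewrite -expr2 sqr_ge0. Qed.

(** The form is the variance of what remains of [x a1 + y a2 + z a3] after its projection onto [v]
    is subtracted; [t] is minus the coefficient of that projection. *)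
Lemma residual_qform_ge0 v a1 a2 a3 : cov v v = 1 -> forall x y z,
  0 <= qform3 (cov a1 a1 - cov v a1 ^+ 2) (cov a2 a2 - cov v a2 ^+ 2)
    (cov a3 a3 - cov v a3 ^+ 2) (cov a2 a3 - cov v a2 * cov v a3)
    (cov a1 a3 - cov v a1 * cov v a3) (cov a1 a2 - cov v a1 * cov v a2) x y z.
Proof.
move=> vv x y z.
pose t := - (x * cov v a1 + y * cov v a2 + z * cov v a3).
have := cov_ge0 (fun i => ((t * v i + x * a1 i) + y * a2 i) + z * a3 i).
rewrite !(covDl mX gX) !(covDr mX gX) !covZl !covZr vv.
rewrite (covC P X a1 v) (covC P X a2 v) (covC P X a3 v).
rewrite (covC P X a2 a1) (covC P X a3 a1) (covC P X a3 a2).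
by congr (_ <= _); rewrite /qform3 /t; ring.
Qed.

Lemma mean_lin_even_gt0 a k : 0 < cov a a -> 0 < mean (fun w => lin a w ^+ (2 * k)).
Proof.
move=> a0; elim: k => [|k ih].
  by rewrite (_ : mean _ = 1) ?ltr01// -[RHS](mean_cst P); exact: mean_ext.
rewrite mulnS add2n (mean_lin_recursion mX gX) /=.
by rewrite !mulr_gt0// ltr0n.
Qed.

End Vector.
End Final.

Unset Implicit Arguments.

Theorem theorem4p2 (d : measure_display) (T : measurableType d) (R : realType)
    (P : probability T R) (m : nat) (hm : (0 < m)%N)
    (X1 X2 X3 X4 : {RV P >-> R})
    (hG : centered_gaussian_vector P (vec4 X1 X2 X3 X4))
    (hV : forall i : 'I_4, (0 < 'V_P[vec4 X1 X2 X3 X4 i])%E) :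
  ('E_P[(fun w => X1 w ^+ (2 * m) * X2 w ^+ 2 * X3 w ^+ 2 * X4 w ^+ 2)%R] >=
   'E_P[(fun w => X1 w ^+ (2 * m))%R] * 'E_P[(fun w => X2 w ^+ 2)%R] *
   'E_P[(fun w => X3 w ^+ 2)%R] * 'E_P[(fun w => X4 w ^+ 2)%R])%E /\
  (('E_P[(fun w => X1 w ^+ (2 * m) * X2 w ^+ 2 * X3 w ^+ 2 * X4 w ^+ 2)%R] =
    'E_P[(fun w => X1 w ^+ (2 * m))%R] * 'E_P[(fun w => X2 w ^+ 2)%R] *
    'E_P[(fun w => X3 w ^+ 2)%R] * 'E_P[(fun w => X4 w ^+ 2)%R])%E <->
   mutually_independent P (vec4 X1 X2 X3 X4)).
Proof.
pose X := vec4 X1 X2 X3 X4.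
have mX i : measurable_fun setT (X i).
  by case: i => [[|[|[|[|i]]]] hi]//; exact: measurable_funP.
pose i0 : 'I_4 := @Ordinal 4 0 isT. pose i1 : 'I_4 := @Ordinal 4 1 isT.
pose i2 : 'I_4 := @Ordinal 4 2 isT. pose i3 : 'I_4 := @Ordinal 4 3 isT.
pose e (i : 'I_4) : 'I_4 -> R := unit_vec i.
have le i w : lin X (e i) w = X i w by exact: lin_unit_vec.
have ce i j : cov P X (e i) (e j) = mean P (fun w => X i w * X j w).
  exact: cov_unit_vec.
have var0 i : 0 < cov P X (e i) (e i).
  have := hV i; rewrite (variance_coord mX hG) lte_fin ce.
  by congr (_ < _); apply: mean_ext => w; rewrite expr2.
pose s := Num.sqrt (cov P X (e i0) (e i0)).
have s0 : 0 < s by rewrite sqrtr_gt0.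
have s2 : s ^+ 2 = cov P X (e i0) (e i0) by rewrite sqr_sqrtr// ltW.
pose v i := s^-1 * e i0 i.
have lv w : lin X v w = s^-1 * X1 w.
  rewrite -[X1 w]/(X i0 w) -(le i0) /lin mulr_sumr.
  by apply: eq_bigr => i _; rewrite mulrA.
have vv : cov P X v v = 1.
  by rewrite (covZl mX hG) (covZr mX hG) -s2 mulKf ?mulVf// ?gt_eqF//; field; rewrite gt_eqF.
have mXi i := all_moments_coord mX hG i.
have m1 : all_moments P X1 := mXi i0. have m2 : all_moments P X2 := mXi i1.
have m3 : all_moments P X3 := mXi i2. have m4 : all_moments P X4 := mXi i3.
pose t := tilted_moment (2 * m)%:R (cov P X v (e i1)) (cov P X v (e i2)) (cov P X v (e i3))
    (cov P X (e i1) (e i1)) (cov P X (e i2) (e i2)) (cov P X (e i3) (e i3))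
    (cov P X (e i2) (e i3)) (cov P X (e i1) (e i3)) (cov P X (e i1) (e i2)).
have M1 : all_moments P (fun w => X1 w ^+ (2 * m)) by exact: all_momentsX.
have M2 : all_moments P (fun w => X2 w ^+ 2) by exact: all_momentsX.
have M3 : all_moments P (fun w => X3 w ^+ 2) by exact: all_momentsX.
have M4 : all_moments P (fun w => X4 w ^+ 2) by exact: all_momentsX.
have lvX : mean P (fun w => lin X v w ^+ (2 * m)) = s^-1 ^+ (2 * m) * mean P (fun w => X1 w ^+ (2 * m)).
  by rewrite -meanZ//; apply: mean_ext => w; rewrite lv exprMn.
have full : mean P (fun w => X1 w ^+ (2 * m) * X2 w ^+ 2 * X3 w ^+ 2 * X4 w ^+ 2) =
    mean P (fun w => X1 w ^+ (2 * m)) * t.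
  (* Both sides are homogeneous of degree [2m] in [X1], so it may be replaced by the normalized
     variable. *)
  have sn : s^-1 ^+ (2 * m) != 0 by rewrite expf_neq0// invr_neq0// gt_eqF.
  apply: (mulfI sn); rewrite mulrA -lvX -(mean_tilted mX hG)//.
  rewrite -meanZ; last by apply: all_momentsM => //; do 2 (apply: all_momentsM => //).
  apply: mean_ext => w; rewrite lv exprMn /linprod !big_cons big_nil !le.
  by rewrite -[X i1 w]/(X2 w) -[X i2 w]/(X3 w) -[X i3 w]/(X4 w); ring.
have g0 : 0 < mean P (fun w => X1 w ^+ (2 * m)).
  have := mean_lin_even_gt0 mX hG m (var0 i0); congr (_ < _).
  by apply: mean_ext => w; rewrite le.
have sq i : cov P X (e i) (e i) = mean P (fun w => X i w ^+ 2).
  by rewrite ce; apply: mean_ext => w; rewrite expr2.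
rewrite !expectation_mean//; last by do 2 (apply: all_momentsM => //); exact: all_momentsM.
rewrite -!EFinM lee_fin full -!mulrA.
rewrite -[mean P (fun w => X2 w ^+ 2)]/(mean P (fun w => X i1 w ^+ 2)) -sq.
rewrite -[mean P (fun w => X3 w ^+ 2)]/(mean P (fun w => X i2 w ^+ 2)) -sq.
rewrite -[mean P (fun w => X4 w ^+ 2)]/(mean P (fun w => X i3 w ^+ 2)) -sq.
have psd := residual_qform_ge0 mX hG (e i1) (e i2) (e i3) vv.
have u2 : 2 <= (2 * m)%:R :> R by rewrite ler_nat -[leqLHS]muln1 leq_mul2l.
split.
  rewrite ler_pM2l// mulrA.
  (* Adding the products of covariances with [v] to the residual covariances restores the entries of
     [t]. *)
  have := prod_le_tilted_moment (cov P X v (e i1)) (cov P X v (e i2)) (cov P X v (e i3)) u2 psd.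
  by rewrite !subrK.
have cvE i : cov P X v (e i) = s^-1 * mean P (fun w => X1 w * X i w).
  by rewrite (covZl mX hG) ce.
split.
  move=> /esym fullE; have tE := mulfI (lt0r_neq0 g0) (EFin_inj (esym fullE)).
  have := @tilted_moment_eq R (2 * m)%:R (cov P X v (e i1)) (cov P X v (e i2))
    (cov P X v (e i3)) _ _ _ _ _ _ u2 psd.
  rewrite !subrK -mulrA => /(_ (var0 i1) (var0 i2) (var0 i3) tE).
  move=> [[a0 b0 c0] [p0 q0 r0]].
  (* As the covariances with [v] vanish, the residual covariances are those of the variables
     themselves. *)
  rewrite a0 b0 c0 ?mulr0 ?mul0r ?subr0 in p0 q0 r0.
  have c01 i : cov P X v (e i) = 0 -> mean P (fun w => X1 w * X i w) = 0.
    rewrite cvE => /eqP; rewrite mulf_eq0 invr_eq0 gt_eqF//= => /eqP//.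
  have C i j : mean P (fun w => X i w * X j w) = 0 -> mean P (fun w => X j w * X i w) = 0.
    by move=> <-; apply: mean_ext => w; rewrite mulrC.
  have h01 := c01 _ a0; have h02 := c01 _ b0; have h03 := c01 _ c0.
  rewrite ce in p0; rewrite ce in q0; rewrite ce in r0.
  apply: (uncorrelated_independent mX hG) => i j.
  by case: i => [[|[|[|[|i]]]] hi]//; case: j => [[|[|[|[|j]]]] hj]// _;
    first [exact: h01|exact: h02|exact: h03|exact: p0|exact: q0|exact: r0|
      exact: C i0 i1 h01|exact: C i0 i2 h02|exact: C i0 i3 h03|
      exact: C i2 i3 p0|exact: C i1 i3 q0|exact: C i1 i2 r0].
(* With all covariances zero, only the product of the three variances survives in [t]. *)
move=> ind; congr EFin; congr (_ * _).
have z i j : i != j -> cov P X (e i) (e j) = 0.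
  by move=> ij; rewrite ce; exact: independent_uncorrelated.
have z0 i : i0 != i -> cov P X v (e i) = 0.
  by move=> ij; rewrite (covZl mX hG) z ?mulr0.
by rewrite /t /tilted_moment (z i2 i3)// (z i1 i3)// (z i1 i2)// (z0 i1)// (z0 i2)// (z0 i3)//; ring.
Qed.
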